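(* Let $n$ be a natural number. Let $N, A$ be unital $\mathbb C$-algebras of dimension $n$, with $A$ semisimple. Choose a Wedderburn decomposition $A\cong\bigoplus_{i=1}^{k'}M_{n_i}(\mathbb C)^{\oplus d_i}$, where $k', n_i, d_i$ are positive integers such that $n=\sum_{i=1}^{k'}n_i^2d_i$. For $1\le i\le k'$ let $g_i(x)\in\mathbb C[t][x]$ be a polynomial in $x$ of degree $d_i$ over $\mathbb C[t]$, with leading coefficient $1$, having no multiple roots in the algebraic closure of $F=\mathbb C\{t\}[t^{-1}]$, and let $u_i$, $A'$, $M$, $M[t,t^{-1}]$, $M\{t\}$ be as defined in the context. If there are a natural number $\rho$ and a unital $\mathbb C\{t\}$-algebra homomorphism $f:\mathbb C\langle x_1,\ldots,x_\rho\rangle\{t\}\to A'$ such that (1) $f(x_j)\in M[t,t^{-1}]$ for $j=1,\ldots,\rho$ (and $f(1)=1_{A'}$); (2) there are $m_1,\ldots,m_n\in\mathbb C\langle x_1,\ldots,x_\rho\rangle$ such that $f(m_1),\ldots,f(m_n)$ are linearly independent over $\mathbb C\{t\}$; (3) there is a natural number $\gamma$ such that $\operatorname{Im}(f)\subseteq t^{-\gamma}M\{t\}$; and such that $\operatorname{Im}(f)/t\cdot\operatorname{Im}(f)$ is isomorphic to $N$ as a $\mathbb C$-algebra, then there is a flat deformation from $N$ to $A$.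
   Context: All algebras are associative and unital (usually noncommutative) and all algebra homomorphisms are unital. $\mathbb C\{t\}$ denotes the ring of formal power series in $t$ over $\mathbb C$ (no convergence assumed), and $F=\mathbb C\{t\}[t^{-1}]$ its field of fractions (Laurent series). $\mathbb C\langle x_1,\ldots,x_\rho\rangle\{t\}$ denotes the free unital associative $\mathbb C\{t\}$-algebra on $x_1,\ldots,x_\rho$ (finite $\mathbb C\{t\}$-linear combinations of words); it contains the free $\mathbb C$-algebra $\mathbb C\langle x_1,\ldots,x_\rho\rangle$. For each $i$, let $I_i$ be the ideal of $F[x]$ generated by $g_i(x)$ and put $u_i=x+I_i\in F[x]/I_i$, so $g_i(u_i)=0$. Put $A'=\bigoplus_{i=1}^{k'}M_{n_i}(\mathbb C\{t\}[t^{-1}][u_i])$, where $\mathbb C\{t\}[t^{-1}][u_i]=F[x]/I_i$ consists of finite sums of elements $c(t)u_i^kt^j$ with $c(t)\in\mathbb C\{t\}$, $k\ge 0$, $j\in\mathbb Z$. Let $M=\bigoplus_{i=1}^{k'}M_{n_i}(\mathbb C+\mathbb Cu_i+\cdots+\mathbb Cu_i^{d_i-1})$, a $\mathbb C$-linear subspace of $A'$. $M[t,t^{-1}]$ is the set of finite sums of elements $mt^j$ with $m\in M$, $j\in\mathbb Z$ (it is an algebra). $M\{t\}=\bigoplus_{i=1}^{k'}M_{n_i}(\mathbb C\{t\}+\mathbb C\{t\}u_i+\cdots+\mathbb C\{t\}u_i^{d_i-1})$, a $\mathbb C\{t\}$-submodule of $A'$. A deformation of a unital $\mathbb C$-algebra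 $N$ over $\mathbb C\{t\}$ is a $\mathbb C\{t\}$-algebra $\mathcal N$ which is a free $\mathbb C\{t\}$-module and such that $\mathcal N/t\mathcal N$ is isomorphic to $N$; it is assumed that the image of the identity element of $N$ is the identity element of $\mathcal N$. A flat deformation from $N$ to a unital algebra $A$ (over $\mathbb C\{t\}$) is such a deformation $\mathcal N$ for which $\mathcal N\otimes_{\mathbb C\{t\}}\mathbb C\{\{t\}\}$ is isomorphic to $A\otimes_{\mathbb C}\mathbb C\{\{t\}\}$, where $\mathbb C\{\{t\}\}$ denotes the algebraic closure of the fraction field of $\mathbb C\{t\}$. *)

(* Defs.v *)
From HB Require Import structures.
From mathcomp Require Import all_boot all_order all_algebra all_field.
From mathcomp Require Import finmap boolp reals.
From mathcomp Require Import complex.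
From mathcomp Require Import monalg.

Set Implicit Arguments.
Unset Strict Implicit.
Unset Printing Implicit Defensive.

Import GRing.Theory.
Local Open Scope ring_scope.
Local Open Scope quotient_scope.

Record fps (k : Type) : Type := Fps { fps_coef : nat -> k }.

HB.instance Definition _ (k : Type) := [isNew for @fps_coef k].
HB.instance Definition _ (k : choiceType) := [Choice of fps k by <:].

Section PowerSeriesRing.
Variable k : comNzRingType.
Implicit Types x y z : fps k.

Local Notation "x ''_' n" := (fps_coef x n) (at level 3, n at level 2).

Lemma fpsP x y : (forall n, x '_ n = y '_ n) -> x = y.
Proof. by case: x y => [a] [b] /= ab; congr Fps; apply/funext. Qed.

Definition fpsC (c : k) : fps k := Fps (fun n => if n is 0%N then c else 0).
Definition fps_opp x : fps k := Fps (fun n => - x '_ n).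
Definition fps_add x y : fps k := Fps (fun n => x '_ n + y '_ n).
Definition fps_mul x y : fps k :=
  Fps (fun n => \sum_(i < n.+1) x '_ i * y '_ (n - i)).

Fact fps_addA : associative fps_add.
Proof. by move=> x y z; apply: fpsP => n /=; rewrite addrA. Qed.
Fact fps_addC : commutative fps_add.
Proof. by move=> x y; apply: fpsP => n /=; rewrite addrC. Qed.
Fact fps_add0 : left_id (fpsC 0) fps_add.
Proof. by move=> x; apply: fpsP => -[|n] /=; rewrite add0r. Qed.
Fact fps_addN : left_inverse (fpsC 0) fps_opp fps_add.
Proof. by move=> x; apply: fpsP => -[|n] /=; rewrite addNr. Qed.

HB.instance Definition _ := GRing.isZmodule.Build (fps k)
  fps_addA fps_addC fps_add0 fps_addN.

Definition fps_trunc n x : {poly k} := \poly_(i < n.+1) x '_ i.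

Fact truncE n x i : (i <= n)%N -> (fps_trunc n x)`_i = x '_ i.
Proof. by move=> le_in; rewrite coef_poly ltnS le_in. Qed.

Fact fps_mul_trunc n x y i : (i <= n)%N ->
  (fps_mul x y) '_ i = (fps_trunc n x * fps_trunc n y)`_i.
Proof.
move=> le_in; rewrite coefM /=; apply: eq_bigr => j _.
by rewrite !truncE ?(leq_trans (leq_subr _ _)) // (leq_trans _ le_in) // -ltnS.
Qed.

Fact fps_mulA : associative fps_mul.
Proof.
move=> x y z; apply: fpsP => n.
transitivity ((fps_trunc n x * (fps_trunc n y * fps_trunc n z))`_n).
  rewrite coefM /=; apply: eq_bigr => j _.
  by rewrite -fps_mul_trunc ?leq_subr // truncE // -ltnS.
rewrite mulrA coefM /=; apply: eq_bigr => j _.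
by rewrite -fps_mul_trunc -1?ltnS // truncE ?leq_subr.
Qed.

Fact fps_mulC : commutative fps_mul.
Proof.
by move=> x y; apply: fpsP => n; rewrite !(@fps_mul_trunc n) // mulrC.
Qed.

Fact fps_mul1 : left_id (fpsC 1) fps_mul.
Proof.
move=> x; apply: fpsP => n /=; rewrite big_ord_recl /= mul1r subn0.
by rewrite big1 ?addr0 // => i _; rewrite mul0r.
Qed.

Fact fps_mulDl : left_distributive fps_mul fps_add.
Proof.
move=> x y z; apply: fpsP => n /=; rewrite -big_split /=.
by apply: eq_bigr => i _; rewrite mulrDl.
Qed.

Fact fps_1_neq0 : fpsC 1 != fpsC 0.
Proof.
apply/negP => /eqP /(congr1 (fun x => x '_ 0)) /= /eqP.
by rewrite (negPf (oner_neq0 k)).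
Qed.

HB.instance Definition _ := GRing.Zmodule_isComNzRing.Build (fps k)
  fps_mulA fps_mulC fps_mul1 fps_mulDl fps_1_neq0.

Lemma fps_coef0 n : (0 : fps k) '_ n = 0. Proof. by case: n. Qed.

Definition fps_unit : {pred fps k} := fun x => `[< exists y, y * x = 1 >].
Definition fps_inv x : fps k :=
  if pselect (exists y, y * x = 1) is left ex then projT1 (cid ex) else x.

Fact fps_mulV : {in fps_unit, left_inverse 1 fps_inv *%R}.
Proof.
move=> x /asboolP ex; rewrite /fps_inv.
by case: pselect => // ex'; exact: projT2 (cid ex').
Qed.
Fact fps_unitP x y : y * x = 1 -> fps_unit x.
Proof. by move=> yx1; apply/asboolP; exists y. Qed.
Fact fps_inv_out : {in [predC fps_unit], fps_inv =1 id}.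
Proof.
move=> x /negP Ux; rewrite /fps_inv; case: pselect => // ex.
by case: Ux; apply/asboolP.
Qed.

HB.instance Definition _ := GRing.ComNzRing_hasMulInverse.Build (fps k)
  fps_mulV fps_unitP fps_inv_out.

Fact fpsC_zmod : zmod_morphism fpsC.
Proof. by move=> a b; apply: fpsP => -[|n] //=; rewrite subr0. Qed.
Fact fpsC_monoid : monoid_morphism fpsC.
Proof.
split=> // a b; apply: fpsP => n /=; rewrite big_ord_recl /= subn0.
by rewrite big1 ?addr0 => [|i _]; [case: n => //= n; rewrite mulr0 | rewrite mul0r].
Qed.
HB.instance Definition _ := GRing.isZmodMorphism.Build k (fps k) fpsC fpsC_zmod.
HB.instance Definition _ :=
  GRing.isMonoidMorphism.Build k (fps k) fpsC fpsC_monoid.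

Definition fps_of_poly (p : {poly k}) : fps k := Fps (fun n => p`_n).

Fact fps_of_poly_zmod : zmod_morphism fps_of_poly.
Proof. by move=> p q; apply: fpsP => n /=; rewrite coefB. Qed.
Fact fps_of_poly_monoid : monoid_morphism fps_of_poly.
Proof.
split=> [|p q]; apply: fpsP => n /=; last by rewrite coefM.
by rewrite coef1; case: n.
Qed.
HB.instance Definition _ :=
  GRing.isZmodMorphism.Build {poly k} (fps k) fps_of_poly fps_of_poly_zmod.
HB.instance Definition _ :=
  GRing.isMonoidMorphism.Build {poly k} (fps k) fps_of_poly fps_of_poly_monoid.

Definition fpsX : fps k := fps_of_poly 'X.

End PowerSeriesRing.

Fact fps_idomain (k : idomainType) : GRing.integral_domain_axiom (fps k).
Proof.
have lowest (x : fps k) : x != 0 ->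
    exists2 n, fps_coef x n != 0 & forall i, (i < n)%N -> fps_coef x i = 0.
  move=> x0; have [n xn] : exists n, fps_coef x n != 0.
    apply: contrapT => /forallNP x_0; move/eqP: x0; apply; apply: fpsP => n.
    by move/negP: (x_0 n); rewrite negbK => /eqP->; rewrite fps_coef0.
  have ex : exists n, fps_coef x n != 0 by exists n.
  case: (ex_minnP ex) => m xm min; exists m => // i lt_im.
  by apply/eqP; apply: contraTT lt_im => /min; rewrite -leqNgt.
move=> x y xy0; apply/orP; have [x0|/lowest[m xm minx]] := eqVneq x 0.
  by left.
have [y0|/lowest[n yn miny]] := eqVneq y 0; first by right.
have : fps_coef (x * y) (m + n) = 0 by rewrite xy0 fps_coef0.
have lt_m : (m < (m + n).+1)%N by rewrite ltnS leq_addr.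
rewrite [LHS](bigD1 (Ordinal lt_m)) //= addKn big1 ?addr0.
  by move=> /eqP; rewrite mulf_eq0 (negPf xm) (negPf yn).
move=> i ne_im; have [lt_im|] := ltnP i m; first by rewrite minx ?mul0r.
rewrite leq_eqVlt => /orP[/eqP eq_mi|lt_mi].
  by move/eqP: ne_im; case; apply: val_inj.
rewrite miny ?mulr0 // ltn_subLR ?ltn_add2r //; last by rewrite -ltnS.
Qed.
HB.instance Definition _ (k : idomainType) :=
  GRing.ComUnitRing_isIntegral.Build (fps k) (@fps_idomain k).

Definition laurent (k : idomainType) : fieldType := {fraction (fps k)}.

Definition fps_laurent (k : idomainType) : {rmorphism fps k -> laurent k} :=
  @FracField.tofrac (fps k).

Definition laurentC (k : idomainType) : {rmorphism k -> laurent k} :=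
  fps_laurent k \o @fpsC k.

Definition laurentT (k : idomainType) : laurent k := fps_laurent k (fpsX k).

(* An [algType] is nonzero by definition, so rings that may be zero a priori
   (quotients, tensor products, images) carry their algebra structure through
   the structure map r |-> r *: 1 from the base ring into their centre. A ring
   isomorphism is an algebra isomorphism iff it commutes with these maps. *)

Definition alg_iso (R : Type) (A B : pzRingType) (a : R -> A) (b : R -> B) :=
  exists phi : {rmorphism A -> B}, bijective phi /\ forall r, phi (a r) = b r.

Section ProductRing.
Variables (I : Type) (A : I -> pzRingType).

Definition prodring : Type := forall i, A i.
HB.instance Definition _ := Choice.copy prodring (forall i, A i).

Implicit Types x y z : prodring.

Definition prod_zero : prodring := fun=> 0.
Definition prod_one : prodring := fun=> 1.
Definition prod_opp x : prodring := fun i => - x i.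
Definition prod_add x y : prodring := fun i => x i + y i.
Definition prod_mul x y : prodring := fun i => x i * y i.

Local Ltac ptwise lem := by move=> *; apply: functional_extensionality_dep => i;
  apply: lem.

Fact prod_addA : associative prod_add. Proof. ptwise addrA. Qed.
Fact prod_addC : commutative prod_add. Proof. ptwise addrC. Qed.
Fact prod_add0 : left_id prod_zero prod_add. Proof. ptwise add0r. Qed.
Fact prod_addN : left_inverse prod_zero prod_opp prod_add.
Proof. ptwise addNr. Qed.
Fact prod_mulA : associative prod_mul. Proof. ptwise mulrA. Qed.
Fact prod_mul1 : left_id prod_one prod_mul. Proof. ptwise mul1r. Qed.
Fact prod_1mul : right_id prod_one prod_mul. Proof. ptwise mulr1. Qed.
Fact prod_mulDl : left_distributive prod_mul prod_add.
Proof. ptwise mulrDl. Qed.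
Fact prod_mulDr : right_distributive prod_mul prod_add.
Proof. ptwise mulrDr. Qed.

HB.instance Definition _ := GRing.isZmodule.Build prodring
  prod_addA prod_addC prod_add0 prod_addN.
HB.instance Definition _ := GRing.Zmodule_isPzRing.Build prodring
  prod_mulA prod_mul1 prod_1mul prod_mulDl prod_mulDr.

End ProductRing.

Record ideal (B : pzRingType) := Ideal {
  ideal_mem :> B -> Prop;
  ideal0 : ideal_mem 0;
  idealB : forall x y, ideal_mem x -> ideal_mem y -> ideal_mem (x - y);
  idealMl : forall b x, ideal_mem x -> ideal_mem (b * x);
  idealMr : forall b x, ideal_mem x -> ideal_mem (x * b)
}.

Section QuotientRing.
Variables (B : pzRingType) (I : ideal B).
Implicit Types x y z : B.

Lemma idealN x : I x -> I (- x).
Proof. by move=> Ix; rewrite -sub0r; apply: idealB => //; apply: ideal0. Qed.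
Lemma idealD x y : I x -> I y -> I (x + y).
Proof. by move=> Ix /idealN Iy; rewrite -[y]opprK; apply: idealB. Qed.

Definition eqideal x y := `[< I (x - y) >].

Fact eqideal_refl : reflexive eqideal.
Proof. by move=> x; apply/asboolP; rewrite subrr; apply: ideal0. Qed.
Fact eqideal_sym : symmetric eqideal.
Proof.
by move=> x y; apply/asboolP/asboolP => /idealN; rewrite opprB.
Qed.
Fact eqideal_trans : transitive eqideal.
Proof.
move=> y x z /asboolP xy /asboolP yz; apply/asboolP.
by have := idealD xy yz; rewrite addrA subrK.
Qed.

Canonical eqideal_equiv :=
  EquivRel eqideal eqideal_refl eqideal_sym eqideal_trans.

Definition quot := {eq_quot eqideal}.
HB.instance Definition _ : EqQuotient _ eqideal quot := EqQuotient.on quot.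
HB.instance Definition _ := Choice.on quot.

Lemma quotP x y : reflect (I (x - y)) (x == y %[mod quot]).
Proof. by rewrite eqmodE; apply: asboolP. Qed.

Definition quot_opp := lift_op1 quot (fun x => - x).
Definition quot_add := lift_op2 quot +%R.
Definition quot_mul := lift_op2 quot *%R.

Fact quot_reprP x : I (x - repr (\pi_quot x)).
Proof. by apply/quotP; rewrite reprK. Qed.

Fact pi_quot_opp : {morph \pi_quot : x / - x >-> quot_opp x}.
Proof.
move=> x; unlock quot_opp; apply/eqP/quotP.
by rewrite -opprD; apply: idealN; apply: quot_reprP.
Qed.
Fact pi_quot_add : {morph \pi_quot : x y / x + y >-> quot_add x y}.
Proof.
move=> x y; unlock quot_add; apply/eqP/quotP.
by rewrite opprD addrACA; apply: idealD; apply: quot_reprP.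
Qed.
Fact pi_quot_mul : {morph \pi_quot : x y / x * y >-> quot_mul x y}.
Proof.
move=> x y; unlock quot_mul; apply/eqP/quotP.
set x' := repr _; set y' := repr _.
have -> : x * y - x' * y' = (x - x') * y + x' * (y - y').
  by rewrite mulrBl mulrBr addrA subrK.
by apply: idealD; [apply: idealMr | apply: idealMl]; apply: quot_reprP.
Qed.
Canonical pi_quot_opp_morph := PiMorph1 pi_quot_opp.
Canonical pi_quot_add_morph := PiMorph2 pi_quot_add.
Canonical pi_quot_mul_morph := PiMorph2 pi_quot_mul.

Fact quot_addA : associative quot_add.
Proof. by do 3![elim/quotW=> ?]; rewrite !piE addrA. Qed.
Fact quot_addC : commutative quot_add.
Proof. by do 2![elim/quotW=> ?]; rewrite !piE addrC. Qed.
Fact quot_add0 : left_id (\pi_quot 0) quot_add.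
Proof. by elim/quotW=> ?; rewrite !piE add0r. Qed.
Fact quot_addN : left_inverse (\pi_quot 0) quot_opp quot_add.
Proof. by elim/quotW=> ?; rewrite !piE addNr. Qed.
HB.instance Definition _ := GRing.isZmodule.Build quot
  quot_addA quot_addC quot_add0 quot_addN.

Fact quot_mulA : associative quot_mul.
Proof. by do 3![elim/quotW=> ?]; rewrite !piE mulrA. Qed.
Fact quot_mul1 : left_id (\pi_quot 1) quot_mul.
Proof. by elim/quotW=> ?; rewrite !piE mul1r. Qed.
Fact quot_1mul : right_id (\pi_quot 1) quot_mul.
Proof. by elim/quotW=> ?; rewrite !piE mulr1. Qed.
Fact quot_mulDl : left_distributive quot_mul quot_add.
Proof. by do 3![elim/quotW=> ?]; rewrite !piE mulrDl. Qed.
Fact quot_mulDr : right_distributive quot_mul quot_add.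
Proof. by do 3![elim/quotW=> ?]; rewrite !piE mulrDr. Qed.
HB.instance Definition _ := GRing.Zmodule_isPzRing.Build quot
  quot_mulA quot_mul1 quot_1mul quot_mulDl quot_mulDr.

Definition quot_proj : B -> quot := \pi_quot.

Fact quot_proj_zmod : zmod_morphism quot_proj.
Proof. by move=> x y; rewrite /quot_proj pi_quot_add pi_quot_opp. Qed.
Fact quot_proj_monoid : monoid_morphism quot_proj.
Proof. by split=> // x y; rewrite /quot_proj pi_quot_mul. Qed.
HB.instance Definition _ :=
  GRing.isZmodMorphism.Build B quot quot_proj quot_proj_zmod.
HB.instance Definition _ :=
  GRing.isMonoidMorphism.Build B quot quot_proj quot_proj_monoid.

End QuotientRing.

Section CentralIdeal.
Variables (B : pzRingType) (c : B) (cC : forall b, c * b = b * c).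

Definition mulset (x : B) : Prop := exists b, x = c * b.

Fact mulset0 : mulset 0. Proof. by exists 0; rewrite mulr0. Qed.
Fact mulsetB x y : mulset x -> mulset y -> mulset (x - y).
Proof. by move=> [a ->] [b ->]; exists (a - b); rewrite mulrBr. Qed.
Fact mulsetMl b x : mulset x -> mulset (b * x).
Proof. by move=> [a ->]; exists (b * a); rewrite !mulrA cC. Qed.
Fact mulsetMr b x : mulset x -> mulset (x * b).
Proof. by move=> [a ->]; exists (a * b); rewrite mulrA. Qed.

Definition central_ideal := Ideal mulset0 mulsetB mulsetMl mulsetMr.

End CentralIdeal.

Section Tensor.
Variables (R K : comNzRingType) (iota : {rmorphism R -> K}) (B : algType R).

(* The list [:: (b1, c1); ...; (bn, cn)] stands for the formal sum
   b1 (x) c1 + ... + bn (x) cn; signs are not needed, -(b (x) c) being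
   (-b) (x) c. *)
Inductive tens_rel : seq (B * K) -> seq (B * K) -> Prop :=
| tens_refl s : tens_rel s s
| tens_sym s1 s2 : tens_rel s1 s2 -> tens_rel s2 s1
| tens_trans s1 s2 s3 : tens_rel s1 s2 -> tens_rel s2 s3 -> tens_rel s1 s3
| tens_cat s1 s2 s3 s4 :
    tens_rel s1 s3 -> tens_rel s2 s4 -> tens_rel (s1 ++ s2) (s3 ++ s4)
| tens_swap s1 s2 : tens_rel (s1 ++ s2) (s2 ++ s1)
| tens_zero c : tens_rel [:: (0, c)] [::]
| tens_addl b1 b2 c : tens_rel [:: (b1 + b2, c)] [:: (b1, c); (b2, c)]
| tens_addr b c1 c2 : tens_rel [:: (b, c1 + c2)] [:: (b, c1); (b, c2)]
| tens_bal r b c : tens_rel [:: (r *: b, c)] [:: (b, iota r * c)].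

Implicit Types s : seq (B * K).

Definition eqtens s1 s2 := `[< tens_rel s1 s2 >].

Fact eqtens_refl : reflexive eqtens.
Proof. by move=> s; apply/asboolP; apply: tens_refl. Qed.
Fact eqtens_sym : symmetric eqtens.
Proof. by move=> s1 s2; apply/asboolP/asboolP; apply: tens_sym. Qed.
Fact eqtens_trans : transitive eqtens.
Proof.
by move=> s2 s1 s3 /asboolP s12 /asboolP s23; apply/asboolP/(tens_trans s12).
Qed.

Canonical eqtens_equiv := EquivRel eqtens eqtens_refl eqtens_sym eqtens_trans.

Definition tens := {eq_quot eqtens}.
HB.instance Definition _ : EqQuotient _ eqtens tens := EqQuotient.on tens.
HB.instance Definition _ := Choice.on tens.

Lemma tensP s1 s2 : reflect (tens_rel s1 s2) (s1 == s2 %[mod tens]).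
Proof. by rewrite eqmodE; apply: asboolP. Qed.

Definition formal_opp s := [seq (- p.1, p.2) | p <- s].
Definition formal_mul s1 s2 := [seq (p.1 * q.1, p.2 * q.2) | p <- s1, q <- s2].

Fact map2_rel f g h s : (forall q, tens_rel [:: f q] [:: g q; h q]) ->
  tens_rel (map f s) (map g s ++ map h s).
Proof.
move=> fgh; elim: s => [|q s IHs] /=; first exact: tens_refl.
rewrite -cat1s; apply: tens_trans (tens_cat (fgh q) IHs) _.
have -> : g q :: (map g s ++ h q :: map h s) =
    [:: g q] ++ ((map g s ++ [:: h q]) ++ map h s) by rewrite -catA.
apply: (tens_cat (s1 := [:: g q]) (s2 := ([:: h q] ++ map g s) ++ map h s)).
  exact: tens_refl.
by apply: tens_cat (tens_refl _); apply: tens_swap.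
Qed.

Fact map1_rel f g s : (forall q, tens_rel [:: f q] [:: g q]) ->
  tens_rel (map f s) (map g s).
Proof.
move=> fg; elim: s => [|q s IHs] /=; first exact: tens_refl.
by rewrite -cat1s -(cat1s (g q)); apply: tens_cat.
Qed.

Fact map0_rel f s : (forall q, tens_rel [:: f q] [::]) -> tens_rel (map f s) [::].
Proof.
move=> f0; elim: s => [|q s IHs] /=; first exact: tens_refl.
by rewrite -cat1s -[[::]]cat0s; apply: tens_cat.
Qed.

Fact formal_opp_rel s1 s2 : tens_rel s1 s2 -> tens_rel (formal_opp s1) (formal_opp s2).
Proof.
elim=> {s1 s2} [s|s1 s2 _|s1 s2 s3 _ IH1 _|s1 s2 s3 s4 _ IH1 _ IH2|s1 s2|c
               |b1 b2 c|b c1 c2|r b c]; rewrite /formal_opp; do ?rewrite map_cat; rewrite /=.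
- exact: tens_refl.
- exact: tens_sym.
- exact: tens_trans.
- exact: tens_cat.
- exact: tens_swap.
- by rewrite oppr0; apply: tens_zero.
- by rewrite opprD; apply: tens_addl.
- exact: tens_addr.
- by rewrite -scalerN; apply: tens_bal.
Qed.

Fact formal_mul_catl s1 s2 s :
  formal_mul (s1 ++ s2) s = formal_mul s1 s ++ formal_mul s2 s.
Proof. by rewrite /formal_mul map_cat flatten_cat. Qed.

Fact formal_mul_rell s s1 s2 : tens_rel s1 s2 -> tens_rel (formal_mul s1 s) (formal_mul s2 s).
Proof.
elim=> {s1 s2} [s1|s1 s2 _|s1 s2 s3 _ IH1 _|s1 s2 s3 s4 _ IH1 _ IH2|s1 s2|c
               |b1 b2 c|b c1 c2|r b c];
  rewrite ?[formal_mul (_ ++ _) _]formal_mul_catl; rewrite /formal_mul /= ?cats0.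
- exact: tens_refl.
- exact: tens_sym.
- exact: tens_trans.
- exact: tens_cat.
- exact: tens_swap.
- by apply: map0_rel => q; rewrite mul0r; apply: tens_zero.
- by apply: map2_rel => q; rewrite mulrDl; apply: tens_addl.
- by apply: map2_rel => q; rewrite mulrDl; apply: tens_addr.
- by apply: map1_rel => q; rewrite -scalerAl -mulrA; apply: tens_bal.
Qed.

Fact formal_mul_nil s : formal_mul s [::] = [::]. Proof. by elim: s. Qed.

Fact formal_mul_cons s p s1 :
  tens_rel (formal_mul s (p :: s1)) (formal_mul s [:: p] ++ formal_mul s s1).
Proof.
elim: s => [|q s IHs]; first exact: tens_refl.
pose x := (q.1 * p.1, q.2 * p.2).
pose m1 := [seq (q.1 * r.1, q.2 * r.2) | r <- s1].
apply: (@tens_cat [:: x] (m1 ++ formal_mul s (p :: s1)) [:: x]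
  (formal_mul s [:: p] ++ (m1 ++ formal_mul s s1)) (tens_refl _)).
apply: tens_trans (tens_cat (tens_refl m1) IHs) _.
rewrite !catA; apply: tens_cat (tens_refl _).
exact: tens_swap.
Qed.

Fact formal_mul_catr s s1 s2 :
  tens_rel (formal_mul s (s1 ++ s2)) (formal_mul s s1 ++ formal_mul s s2).
Proof.
elim: s1 => [|p s1 IHs] /=; last first.
  apply: tens_trans (formal_mul_cons _ _ _) _.
  apply: tens_trans (tens_cat (tens_refl _) IHs) _.
  rewrite catA; apply: tens_cat; last exact: tens_refl.
  exact/tens_sym/formal_mul_cons.
by rewrite formal_mul_nil; apply: tens_refl.
Qed.

Fact formal_mul_seq1 s p : formal_mul s [:: p] = [seq (q.1 * p.1, q.2 * p.2) | q <- s].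
Proof. by rewrite /formal_mul; elim: s => //= q s ->. Qed.

Fact formal_mul_relr s s1 s2 : tens_rel s1 s2 -> tens_rel (formal_mul s s1) (formal_mul s s2).
Proof.
elim=> {s1 s2} [s1|s1 s2 _|s1 s2 s3 _ IH1 _|s1 s2 s3 s4 _ IH1 _ IH2|s1 s2|c
               |b1 b2 c|b c1 c2|r b c].
- exact: tens_refl.
- exact: tens_sym.
- exact: tens_trans.
- apply: tens_trans (formal_mul_catr _ _ _) _.
  apply: tens_trans (tens_cat IH1 IH2) _.
  exact/tens_sym/formal_mul_catr.
- apply: tens_trans (formal_mul_catr _ _ _) _.
  apply: tens_trans (tens_swap _ _) _.
  exact/tens_sym/formal_mul_catr.
- rewrite formal_mul_seq1 formal_mul_nil; apply: map0_rel => q; rewrite mulr0.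
  exact: tens_zero.
- apply: tens_trans _ (tens_sym (formal_mul_cons _ _ _)); rewrite !formal_mul_seq1.
  by apply: map2_rel => q; rewrite mulrDr; apply: tens_addl.
- apply: tens_trans _ (tens_sym (formal_mul_cons _ _ _)); rewrite !formal_mul_seq1.
  by apply: map2_rel => q; rewrite mulrDr; apply: tens_addr.
- rewrite !formal_mul_seq1; apply: map1_rel => q; rewrite -scalerAr mulrCA.
  exact: tens_bal.
Qed.

Definition tens_opp := lift_op1 tens formal_opp.
Definition tens_add := lift_op2 tens cat.
Definition tens_mul := lift_op2 tens formal_mul.

Fact tens_reprP s : tens_rel s (repr (\pi_tens s)).
Proof. by apply/tensP; rewrite reprK. Qed.

Fact pi_tens_opp : {morph \pi_tens : s / formal_opp s >-> tens_opp s}.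
Proof.
by move=> s; unlock tens_opp; apply/eqP/tensP/formal_opp_rel/tens_reprP.
Qed.
Fact pi_tens_add : {morph \pi_tens : s1 s2 / s1 ++ s2 >-> tens_add s1 s2}.
Proof.
by move=> s1 s2; unlock tens_add; apply/eqP/tensP/tens_cat; apply: tens_reprP.
Qed.
Fact pi_tens_mul : {morph \pi_tens : s1 s2 / formal_mul s1 s2 >-> tens_mul s1 s2}.
Proof.
move=> s1 s2; unlock tens_mul; apply/eqP/tensP.
apply: tens_trans (formal_mul_rell _ (tens_reprP s1)) _.
exact: formal_mul_relr (tens_reprP s2).
Qed.
Canonical pi_tens_opp_morph := PiMorph1 pi_tens_opp.
Canonical pi_tens_add_morph := PiMorph2 pi_tens_add.
Canonical pi_tens_mul_morph := PiMorph2 pi_tens_mul.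

Fact tens_addA : associative tens_add.
Proof. by do 3![elim/quotW=> ?]; rewrite !piE catA. Qed.
Fact tens_addC : commutative tens_add.
Proof. by do 2![elim/quotW=> ?]; rewrite !piE; apply/eqP/tensP/tens_swap. Qed.
Fact tens_add0 : left_id (\pi_tens [::]) tens_add.
Proof. by elim/quotW=> ?; rewrite !piE. Qed.
Fact tens_addN : left_inverse (\pi_tens [::]) tens_opp tens_add.
Proof.
elim/quotW=> s; rewrite !piE; apply/eqP/tensP.
rewrite -[X in _ ++ X](@map_id _ s); apply: tens_sym.
apply: tens_trans _ (@map2_rel (fun p => (0, p.2)) _ _ _ _).
  by apply/tens_sym/map0_rel => q; apply: tens_zero.
by case=> b c /=; rewrite -[X in (X, _) :: nil](addNr b); apply: tens_addl.
Qed.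
HB.instance Definition _ := GRing.isZmodule.Build tens
  tens_addA tens_addC tens_add0 tens_addN.

Fact formal_mul_map s2 s3 p :
  formal_mul (map (fun q => (p.1 * q.1, p.2 * q.2)) s2) s3 =
  map (fun q => (p.1 * q.1, p.2 * q.2)) (formal_mul s2 s3).
Proof.
elim: s2 => //= q s2 IHs; rewrite map_cat -IHs; congr (_ ++ _).
by rewrite -map_comp; apply: eq_map => r /=; rewrite !mulrA.
Qed.

Fact formal_mulA : associative formal_mul.
Proof.
move=> s1 s2 s3; elim: s1 => [//|p s1 IHs].
transitivity ([seq (p.1 * q.1, p.2 * q.2) | q <- formal_mul s2 s3] ++
  formal_mul s1 (formal_mul s2 s3)); first by [].
by rewrite IHs -formal_mul_map -formal_mul_catl.
Qed.

Fact tens_mulA : associative tens_mul.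
Proof. by do 3![elim/quotW=> ?]; rewrite !piE formal_mulA. Qed.
Fact tens_mul1 : left_id (\pi_tens [:: (1, 1)]) tens_mul.
Proof.
elim/quotW=> s; rewrite !piE /formal_mul /= cats0; congr (\pi _).
by rewrite -[RHS]map_id; apply: eq_map => -[b c] /=; rewrite !mul1r.
Qed.
Fact tens_1mul : right_id (\pi_tens [:: (1, 1)]) tens_mul.
Proof.
elim/quotW=> s; rewrite !piE formal_mul_seq1; congr (\pi _).
by rewrite -[RHS]map_id; apply: eq_map => -[b c] /=; rewrite !mulr1.
Qed.
Fact tens_mulDl : left_distributive tens_mul tens_add.
Proof. by do 3![elim/quotW=> ?]; rewrite !piE formal_mul_catl. Qed.
Fact tens_mulDr : right_distributive tens_mul tens_add.
Proof. by do 3![elim/quotW=> ?]; rewrite !piE; apply/eqP/tensP/formal_mul_catr. Qed.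
HB.instance Definition _ := GRing.Zmodule_isPzRing.Build tens
  tens_mulA tens_mul1 tens_1mul tens_mulDl tens_mulDr.

Definition pure_tens (b : B) (c : K) : tens := \pi_tens [:: (b, c)].
Definition tens_scalar (c : K) : tens := pure_tens 1 c.

End Tensor.

Section Image.
Variables (B D : pzRingType) (f : {rmorphism B -> D}).

Definition in_image : {pred D} := fun d => `[< exists b, f b = d >].

Fact image_subring : subring_closed in_image.
Proof.
split=> [|_ _ /asboolP[a <-] /asboolP[b <-]|_ _ /asboolP[a <-] /asboolP[b <-]];
  apply/asboolP.
- by exists 1; rewrite rmorph1.
- by exists (a - b); rewrite rmorphB.
- by exists (a * b); rewrite rmorphM.
Qed.

Record imring : Type := ImRing { imring_val : D; imring_valP : imring_val \in in_image }.

HB.instance Definition _ := [isSub for imring_val].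
HB.instance Definition _ := [Choice of imring by <:].
HB.instance Definition _ :=
  GRing.SubChoice_isSubPzRing.Build D in_image imring image_subring.

Fact mem_image b : f b \in in_image.
Proof. by apply/asboolP; exists b. Qed.
Definition to_imring (b : B) : imring := ImRing (mem_image b).

Lemma to_imring_central (c : B) :
  (forall b, c * b = b * c) -> forall a, to_imring c * a = a * to_imring c.
Proof.
move=> cC [a /[dup] /asboolP[b fb] aP]; apply: val_inj => /=.
by rewrite -fb -!rmorphM cC.
Qed.

End Image.

Definition semisimple (k : fieldType) (A : falgType k) : Prop :=
  forall U : {vspace A}, (fullv * U <= U)%VS ->
  exists W : {vspace A},
    [/\ (fullv * W <= W)%VS, (U + W = fullv)%VS & (U :&: W = 0)%VS].

(* [{malg R[I]}] is the module of finitely supported functions I -> R *)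
Definition free_module (R : nzRingType) (V : lmodType R) : Prop :=
  exists (I : choiceType) (phi : {linear {malg R[I]} -> V}), bijective phi.

Fact in_alg_central (R : nzRingType) (B : algType R) (r : R) (b : B) :
  r%:A * b = b * r%:A.
Proof. by rewrite -scalerAl mul1r -scalerAr mulr1. Qed.

Section Deformation.
Variable k : fieldType.

Definition special_fiber (D : algType (fps k)) : pzRingType :=
  quot (central_ideal (in_alg_central (B := D) (fpsX k))).

Definition special_scalar (D : algType (fps k)) (c : k) : special_fiber D :=
  quot_proj _ (fpsC c)%:A.

(* The identity of N corresponds to that of D because ring morphisms, hence
   the isomorphisms of [alg_iso], are unital. *)
Definition is_deformation (N : algType k) (D : algType (fps k)) : Prop :=
  free_module D /\ alg_iso (fun c : k => c%:A : N) (@special_scalar D).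

Definition is_alg_closure (F : fieldType) (K : closedFieldType)
    (iota : {rmorphism F -> K}) : Prop :=
  forall z : K, algebraicOver iota z.

Variables (K : closedFieldType) (iota : {rmorphism laurent k -> K}).

Definition fps_closure : {rmorphism fps k -> K} := iota \o fps_laurent k.
Definition const_closure : {rmorphism k -> K} := iota \o laurentC k.

Definition flat_deformation (N A : algType k) : Prop :=
  exists D : algType (fps k), is_deformation N D /\
    alg_iso (@tens_scalar _ _ fps_closure D) (@tens_scalar _ _ const_closure A).

End Deformation.

Section Construction.
Variables (k : fieldType) (q : nat) (n d : 'I_q -> nat).

Definition wedderburn : pzRingType :=
  prodring (fun i => prodring (fun _ : 'I_(d i) => 'M[k]_(n i))).

Definition wedderburn_scalar (c : k) : wedderburn := fun i j => c%:M.

(* {poly {poly k}} is k[t][x]: the inner variable is t. *)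
Definition laurent_poly (g : {poly {poly k}}) : {poly laurent k} :=
  map_poly (fun a => fps_laurent k (fps_of_poly a)) g.

Variable g : 'I_q -> {poly {poly k}}.

Local Notation h i := (laurent_poly (g i)).

(* [{poly %/ h}] is the quotient by the ideal of h provided that h is monic
   and nonconstant; 'qX is then the class u of x. *)
Definition matalg : pzRingType :=
  prodring (fun i => 'M[{poly %/ h i}]_(n i)).

Definition matalg_scalar (c : laurent k) : matalg := fun i => (c%:A)%:M.

(* The entries of the i-th block lie in S + S u_i + ... + S u_i^(d_i - 1). *)
Definition matspan (S : laurent k -> Prop) (a : matalg) : Prop :=
  forall i r s, exists c : 'I_(d i) -> laurent k,
    (forall j, S (c j)) /\ a i r s = \sum_j c j *: 'qX ^+ j.

Definition in_M : matalg -> Prop := matspan (fun c => exists a, laurentC k a = c).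

Definition in_M_fps : matalg -> Prop :=
  matspan (fun c => exists a, fps_laurent k a = c).

Definition in_M_laurent (a : matalg) : Prop :=
  exists (L : nat) (m : 'I_L -> matalg) (e : 'I_L -> int),
    (forall l, in_M (m l)) /\
    a = \sum_l m l * matalg_scalar (laurentT k ^ e l).

End Construction.

Fact malg_scalerAr (M : monomType) (R : comNzRingType) (c : R)
  (p q : {malg R[M]}) : c *: (p * q) = p * (c *: q).
Proof.
have malgC_comm : @malgC M R c * p = p * malgC c.
  rewrite !malgM_def fgmulUg fgmulgU; apply: eq_bigr => w _.
  by rewrite mul1m mulm1 mulrC.
by rewrite -(mul_malgC c (p * q)) -(mul_malgC c q) !mulrA malgC_comm.
Qed.

Section FreeAlgebra.
Variables (k : fieldType) (rho : nat).

(* The free algebra is the monoid algebra of the free monoid of words. *)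
Definition free_alg : Type := {malg (fps k)[{fmonom 'I_rho}]}.
HB.instance Definition _ := GRing.Lalgebra.on free_alg.
HB.instance Definition _ :=
  GRing.Lalgebra_isAlgebra.Build (fps k) free_alg
    (@malg_scalerAr {fmonom 'I_rho} (fps k)).

Definition free_var (j : 'I_rho) : free_alg := << 1 *g fmu j >>.

(* k<x_1, ..., x_rho> inside its extension of scalars to k[[t]] *)
Definition const_coefs (p : free_alg) : Prop :=
  forall w, exists a : k, p@_w = fpsC a.

Variables (D : pzRingType) (s : laurent k -> D) (f : {rmorphism free_alg -> D}).

Definition fps_linear : Prop := forall c p, f (c *: p) = s (fps_laurent k c) * f p.

Definition imring_fiber : pzRingType :=
  quot (central_ideal (to_imring_central (f := f)
    (in_alg_central (B := free_alg) (fpsX k)))).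

Definition imring_scalar (c : k) : imring_fiber :=
  quot_proj _ (to_imring f (fpsC c)%:A).

End FreeAlgebra.

(* Main.v *)
Require Import Defs.
From HB Require Import structures.
From mathcomp Require Import all_boot all_order all_algebra all_field.
From mathcomp Require Import boolp monalg.
From mathcomp Require Import reals complex.

Set Implicit Arguments.
Unset Strict Implicit.
Unset Printing Implicit Defensive.

Import GRing.Theory.
Local Open Scope ring_scope.

(** Write O for the power series ring, L for its field of fractions, A' for the
    sum of the matrix algebras over the rings L[x]/(g_i). The deformation is the
    image B of f, with its O-algebra structure ([image_alg]); that its special
    fiber is N is the hypothesis on Im f / t Im f ([image_special_fiber]).

    B is free of rank n over O. Boundedness puts B inside t^(-gamma) M{t}, which
    is O^n up to a scaling. Ideals of O being principal, every submodule of O^n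
    is spanned by n vectors ([fps_submodule_span]); for B their determinant is
    nonzero, because B contains n independent elements, whose coordinates are
    combinations of these vectors ([bounded_image_basis]). Hence the n
    generators of B are not only a basis of B over O, but also a basis of A'
    over L.

    It remains to identify the tensor products of B and of A with K. Both are
    the sum W of the algebras M_{n_i}(K)^{d_i}. For A this is its Wedderburn
    decomposition, with scalars extended ([wedderburn_tensor]). For B
    ([image_tensor]), each g_i has d_i distinct roots in K, and evaluation at
    these roots is a ring morphism from A' to W. A polynomial of degree less than
    d_i is determined by its values at the roots, so evaluation maps an L-basis
    of A' to a K-basis of W ([block_eval_independent]). In both cases the
    conclusion comes from [tensor_iso]: a morphism from an algebra to W which
    maps some spanning family to a K-basis of W extends to an isomorphism from
    the tensor product with K to W.

    The bases are compared through coordinates: A' and W have the same index set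
    of coordinates, whose cardinal is the sum of the n_i^2 d_i, and a family of
    that cardinal is a basis exactly when its coordinate matrix is
    invertible. *)

(** * Ring isomorphisms *)

Lemma inj_surj_bijective (A B : Type) (f : A -> B) :
  injective f -> (forall y, exists x, f x = y) -> bijective f.
Proof.
move=> f_inj f_surj; pose f' y := projT1 (cid (f_surj y)).
have f'K : cancel f' f by move=> y; rewrite /f'; case: cid.
by exists f' => // x; apply: f_inj.
Qed.

(** A way to get a morphism from a function in the middle of a proof, where no
    instance can be declared. *)
Section Iso.
Variables (A B : pzRingType) (f : A -> B).
Hypotheses (f_zmod : zmod_morphism f) (f_monoid : monoid_morphism f).

Definition rmorph_fun : A -> B := f.
HB.instance Definition _ := GRing.isZmodMorphism.Build A B rmorph_fun f_zmod.
HB.instance Definition _ := GRing.isMonoidMorphism.Build A B rmorph_fun f_monoid.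
Definition to_rmorph : {rmorphism A -> B} := rmorph_fun.

Lemma alg_iso_of (S : Type) (a : S -> A) (b : S -> B) :
    injective f -> (forall y, exists x, f x = y) ->
    (forall r, f (a r) = b r) -> alg_iso a b.
Proof.
move=> f_inj f_surj f_ab; exists to_rmorph.
by split=> //; apply: inj_surj_bijective.
Qed.

End Iso.

Lemma alg_iso_sym (S : Type) (A B : pzRingType) (a : S -> A) (b : S -> B) :
  alg_iso a b -> alg_iso b a.
Proof.
case=> phi [[psi phiK psiK] phi_ab].
apply: (@alg_iso_of _ _ psi) => [|||x|r].
- exact: can2_zmod_morphism phiK psiK.
- exact: can2_monoid_morphism phiK psiK.
- exact: can_inj psiK.
- by exists (phi x).
- by rewrite -phi_ab.
Qed.

Lemma alg_iso_trans (S : Type) (A B C : pzRingType)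
    (a : S -> A) (b : S -> B) (c : S -> C) :
  alg_iso a b -> alg_iso b c -> alg_iso a c.
Proof.
case=> phi [phi_bij phi_ab] [psi [psi_bij psi_bc]]; exists (psi \o phi); split.
  exact: bij_comp.
by move=> r /=; rewrite phi_ab.
Qed.

(** The first isomorphism theorem, for rings with a map from [S] standing for
    the scalars. *)
Lemma quot_iso (S : Type) (B C : pzRingType) (I : ideal B) (a : S -> quot I)
    (c : S -> C) (theta : {rmorphism B -> C}) :
    (forall x, I x <-> theta x = 0) -> (forall y, exists x, theta x = y) ->
    (forall r, exists2 x, a r = quot_proj I x & theta x = c r) ->
  alg_iso a c.
Proof.
move=> kerI theta_surj theta_ac; pose f (x : quot I) := theta (repr x).
have fE x : f (quot_proj I x) = theta x.
  apply/esym/eqP; rewrite -subr_eq0 -rmorphB; apply/eqP/kerI.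
  exact: quot_reprP.
have projK (x : quot I) : exists y, x = quot_proj I y.
  by exists (repr x); rewrite /quot_proj reprK.
apply: (@alg_iso_of _ _ f) => [x y||x y|y|r].
- case: (projK x) => {x}x ->; case: (projK y) => {y}y ->.
  by rewrite -(rmorphB (quot_proj I)) !fE rmorphB.
- split=> [|x y]; first by rewrite -(rmorph1 (quot_proj I)) fE rmorph1.
  case: (projK x) => {x}x ->; case: (projK y) => {y}y ->.
  by rewrite -(rmorphM (quot_proj I)) !fE rmorphM.
- case: (projK x) => {x}x ->; case: (projK y) => {y}y ->.
  by rewrite !fE => xy; apply/eqP/(Defs.quotP I)/kerI; rewrite rmorphB xy subrr.
- by have [x <-] := theta_surj y; exists (quot_proj I x); rewrite fE.
- by have [x -> <-] := theta_ac r; rewrite fE.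
Qed.

(** * Bases and extension of scalars *)

Section Basis.
Variables (R B : pzRingType) (s : R -> B) (n : nat) (b : 'I_n -> B).

Definition spanning := forall x, exists c : 'I_n -> R, x = \sum_j s (c j) * b j.
Definition independent :=
  forall c : 'I_n -> R, \sum_j s (c j) * b j = 0 -> forall j, c j = 0.

End Basis.

(** Every tensor is a sum of tensors [b j] (x) [c j], and the image of this sum
    in [W] determines the coefficients [c j]; this gives injectivity without
    knowing that [b] is free over [R]. *)
Lemma tensor_iso (R K : comNzRingType) (iota : {rmorphism R -> K})
    (B : algType R) (W : pzRingType) (s : {rmorphism K -> W})
    (psi : {rmorphism B -> W}) (n : nat) (b : 'I_n -> B) :
    (forall c w, s c * w = w * s c) ->
    (forall r x, psi (r *: x) = s (iota r) * psi x) ->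
    spanning (fun r : R => r%:A) b ->
    spanning s (psi \o b) -> independent s (psi \o b) ->
  alg_iso (@tens_scalar R K iota B) s.
Proof.
move=> sC psiZ b_span psib_span psib_ind.
pose ev (l : seq (B * K)) := \sum_(p <- l) s p.2 * psi p.1.
have ev_rel l1 l2 : tens_rel iota l1 l2 -> ev l1 = ev l2.
  elim=> {l1 l2} //.
  - by move=> l1 l2 l3 _ -> _ ->.
  - move=> l1 l2 l3 l4 _ e13 _ e24.
    by rewrite /ev !big_cat /= -/(ev _) e13 -/(ev _) e24.
  - by move=> l1 l2; rewrite /ev !big_cat /= addrC.
  - by move=> c; rewrite /ev big_seq1 big_nil rmorph0 mulr0.
  - by move=> b1 b2 c; rewrite /ev !(big_cons, big_nil) /= rmorphD mulrDr !addr0.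
  - by move=> x c1 c2; rewrite /ev !(big_cons, big_nil) /= rmorphD mulrDl !addr0.
  - by move=> r x c; rewrite /ev !(big_cons, big_nil) /= psiZ rmorphM !addr0
                             mulrA [s c * _]sC.
pose pi l : tens iota B := \pi_(tens iota B)%qT l.
have piD l1 l2 : pi l1 + pi l2 = pi (l1 ++ l2) by rewrite /pi pi_tens_add.
pose f (x : tens iota B) := ev (repr x).
have fE l : f (pi l) = ev l.
  by apply/esym/ev_rel/tens_reprP.
have evD l1 l2 : ev (l1 ++ l2) = ev l1 + ev l2 by rewrite /ev big_cat.
have evN l : ev (formal_opp l) = - ev l.
  by rewrite /ev big_map -sumrN; apply: eq_bigr => p _; rewrite /= rmorphN mulrN.
have evM l1 l2 : ev (formal_mul l1 l2) = ev l1 * ev l2.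
  rewrite /ev /formal_mul big_allpairs_dep /= mulr_suml; apply: eq_bigr => p _.
  rewrite mulr_sumr; apply: eq_bigr => q _.
  by rewrite !rmorphM -!mulrA; congr (_ * _); rewrite !mulrA sC.
have pure0 x : pure_tens iota x (0 : K) = 0.
  have := tens_bal iota 0 x (0 : K); rewrite scale0r rmorph0 mul0r => x0.
  by apply/eqP/tensP/(tens_trans (tens_sym x0))/tens_zero.
have normal (x : tens iota B) :
    exists c : 'I_n -> K, x = \sum_j pure_tens iota (b j) (c j).
  elim/quotW: x => l; rewrite -/(pi l); elim: l => [|[x c] l [d IHl]].
    by exists (fun=> 0); rewrite big1 // => j _; apply: pure0.
  have [r ->] := b_span x.
  exists (fun j => iota (r j) * c + d j).
  have -> : pi ((\sum_j (r j)%:A * b j, c) :: l) =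
            pure_tens iota (\sum_j (r j)%:A * b j) c + pi l.
    by rewrite piD.
  have pD : {morph (fun y : B => pure_tens iota y c) : y z / y + z}.
    by move=> y z; rewrite [RHS]piD; apply/eqP/tensP/tens_addl.
  have p0 : pure_tens iota (0 : B) c = 0 by apply/eqP/tensP/tens_zero.
  rewrite IHl (big_morph _ pD p0) -big_split /=; apply: eq_bigr => j _.
  rewrite -scalerAl mul1r.
  transitivity (pure_tens iota (b j) (iota (r j) * c) + pure_tens iota (b j) (d j)).
    by congr (_ + _); apply/eqP/tensP/tens_bal.
  by rewrite [LHS]piD; apply/eqP/tensP/tens_sym/tens_addr.
have fD : zmod_morphism f.
  elim/quotW=> l1; elim/quotW=> l2; rewrite -/(pi l1) -/(pi l2).
  have -> : - pi l2 = pi (formal_opp l2).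
    by rewrite /pi pi_tens_opp.
  by rewrite piD !fE evD evN.
have f_sum (I : finType) (c : I -> tens iota B) : f (\sum_j c j) = \sum_j f (c j).
  have f0 : f 0 = 0 by rewrite -(subrr 0) fD subrr.
  have fN x : f (- x) = - f x by rewrite -sub0r fD f0 sub0r.
  apply: (big_morph f _ f0) => x y.
  by rewrite -[in LHS](opprK y) fD fN opprK.
have f_pure x c : f (pure_tens iota x c) = s c * psi x.
  by rewrite fE /ev big_seq1.
apply: (@alg_iso_of _ _ f) => //.
- split=> [|x y]; first by rewrite fE /ev big_seq1 /= !rmorph1 mulr1.
  elim/quotW: x => l1; elim/quotW: y => l2; rewrite -/(pi l1) -/(pi l2).
  have -> : pi l1 * pi l2 = pi (formal_mul l1 l2) by rewrite /pi pi_tens_mul.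
  by rewrite !fE evM.
- move=> x y fxy; apply/eqP; rewrite -subr_eq0; apply/eqP.
  have : f (x - y) = 0 by rewrite fD fxy subrr.
  have [c ->] := normal (x - y); rewrite f_sum.
  under eq_bigr do rewrite f_pure; move/psib_ind => c0.
  by apply: big1 => j _; rewrite c0 pure0.
- move=> w; have [c ->] := psib_span w.
  exists (\sum_j pure_tens iota (b j) (c j)).
  by rewrite f_sum; apply: eq_bigr => j _; rewrite f_pure.
- by move=> c; rewrite f_pure rmorph1 mulr1.
Qed.

(** * Submodules of free modules over power series *)

Section PowerSeries.
Variable k : fieldType.

(** Division by a series of order [n]: the quotient is read off one coefficient
    at a time, [step] cancelling the term of degree [n] and shifting. *)
Lemma fps_divides (n : nat) (p y : fps k) :
    (forall i, (i < n)%N -> fps_coef p i = 0) -> fps_coef p n != 0 ->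
    (forall i, (i < n)%N -> fps_coef y i = 0) ->
  exists q, y = q * p.
Proof.
move=> p_lt pn0 y_lt.
pose lead (z : fps k) := fps_coef z n / fps_coef p n.
pose step z : fps k := Fps (fun i => fps_coef z i.+1 - lead z * fps_coef p i.+1).
exists (Fps (fun i => lead (iter i step y))); apply: fpsP => m.
elim: m y y_lt => [|m IHm] y y_lt.
  rewrite [RHS]big_ord1 /= subnn; case: (posnP n) => [n0|n_gt0].
    by rewrite /lead n0 divfK // -n0.
  by rewrite y_lt // p_lt // mulr0.
rewrite [RHS]big_ord_recl /= subn0.
have /IHm : forall i, (i < n)%N -> fps_coef (step y) i = 0.
  move=> i; rewrite leq_eqVlt => /orP[/eqP eq_in|lt_in] /=.
    by rewrite eq_in /lead divfK ?subrr.
  by rewrite y_lt // p_lt // mulr0 subrr.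
rewrite [RHS]/=; under eq_bigr do rewrite -iterSr.
by move=> <- /=; rewrite addrC subrK.
Qed.

(** A nonzero ideal is generated by any of its elements of least order, by
    [fps_divides]. *)
Lemma fps_principal (I : fps k -> Prop) :
    I 0 -> (forall x y, I x -> I y -> I (x - y)) -> (forall a x, I x -> I (a * x)) ->
  exists2 p, I p & forall y, I y -> exists q, y = q * p.
Proof.
move=> I0 IB IM.
have [ex|no] := pselect (exists n, exists2 p, I p & fps_coef p n != 0); last first.
  exists 0 => // y Iy; exists 0; rewrite mul0r; apply: fpsP => n.
  rewrite fps_coef0; apply/eqP; apply: contra_notT no => yn.
  by exists n, y.
have ex' : exists n, `[< exists2 p, I p & fps_coef p n != 0 >].
  by case: ex => n ex; exists n; apply/asboolP.
case: (ex_minnP ex') => n /asboolP[p Ip pn] n_min.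
have lt_n y i : I y -> (i < n)%N -> fps_coef y i = 0.
  move=> Iy; rewrite ltnNge => /negP lt_in; apply/eqP.
  by apply: contra_notT lt_in => yi; apply: n_min; apply/asboolP; exists y.
exists p => // y Iy; apply: (@fps_divides n) => // i; exact: lt_n.
Qed.

(** By induction on [n]: the first coordinates of [S] form an ideal, generated
    by the first coordinate [p] of some vector; subtracting a multiple of this
    vector moves any element of [S] into the part with first coordinate zero.
    The generators are the rows of a block triangular matrix. *)
Lemma fps_submodule_span (n : nat) (S : 'rV[fps k]_n -> Prop) :
    S 0 -> (forall v w, S v -> S w -> S (v - w)) -> (forall a v, S v -> S (a *: v)) ->
  exists2 G : 'M[fps k]_n, forall j, S (row j G) &
    forall v, S v -> exists c : 'rV_n, v = c *m G.
Proof.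
elim: n S => [|n IHn] S S0 SB SZ.
  exists 0 => [[] //|v _]; exists 0; rewrite mul0mx; exact: thinmx0.
have {}S0 : S (row_mx (0 : 'M_1) (0 : 'rV_n)) by rewrite row_mx0.
have {}SB (x y : 'M_1) (v w : 'rV_n) :
    S (row_mx x v) -> S (row_mx y w) -> S (row_mx (x - y) (v - w)).
  by move=> Sv Sw; rewrite -add_row_mx -opp_row_mx; apply: SB.
have {}SZ a (x : 'M_1) (v : 'rV_n) : S (row_mx x v) -> S (row_mx (a *: x) (a *: v)).
  by move=> Sv; rewrite -scale_row_mx; apply: SZ.
have [//|v w Sv Sw|a v Sv|G' SG' spanG'] := IHn (fun v => S (row_mx (0 : 'M_1) v)).
- by rewrite -[0](subrr 0); apply: SB.
- by rewrite -[0](scaler0 _ a); apply: SZ.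
have [|x y [v Sv] [w Sw]|a x [v Sv]|p [v0 Sv0] p_gen] :=
  @fps_principal (fun x => exists v : 'rV_n, S (row_mx (x%:M : 'M_1) v)).
- by exists 0; rewrite raddf0.
- by exists (v - w); rewrite raddfB; apply: SB.
- by exists (a *: v); rewrite -scale_scalar_mx; apply: SZ.
exists (block_mx (p%:M : 'M_1) v0 0 G') => [j|v Sv].
  rewrite -(@splitK 1 n j) /block_mx; case: (@split 1 n j) => i /=.
    rewrite (@rowKu _ 1 n (1 + n)).
    by rewrite row_id.
  rewrite (@rowKd _ 1 n (1 + n)).
  by rewrite row_row_mx row0; apply: SG'.
rewrite -(@hsubmxK _ 1 1 n v) in Sv *.
move: (lsubmx _) (rsubmx _) Sv => x w; rewrite (mx11_scalar x).
move: {x}(x 0 0) => x Sv.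
have [|q xq] := p_gen x; first by exists w.
have /spanG'[c wc] : S (row_mx (0 : 'M_1) (w - q *: v0)).
  by have := SB _ _ _ _ Sv (SZ q _ _ Sv0); rewrite scale_scalar_mx -xq subrr.
exists (row_mx q%:M c); rewrite [LHS]/=.
rewrite (@mul_row_block _ 1 1 n 1 n) mulmx0 addr0 -wc -scalar_mxM -xq.
by rewrite mul_scalar_mx addrC subrK.
Qed.

End PowerSeries.

(** * Coordinates in the Wedderburn and matrix algebras *)

(** Being a basis is turned into the invertibility of one matrix, because this is
    what passes from a field to a larger one, and from [A'] to the Wedderburn
    algebra over [K]. *)
Section Coordinates.
Variables (F : fieldType) (B : pzRingType) (s : F -> B) (N : nat).
Variable co : {additive B -> 'rV[F]_N}.
Hypothesis coZ : forall c x, co (s c * x) = c *: co x.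
Implicit Type b : 'I_N -> B.

Definition coord_mx b : 'M[F]_N := \matrix_j co (b j).

Lemma coord_sum b (c : 'I_N -> F) :
  co (\sum_j s (c j) * b j) = (\row_j c j) *m coord_mx b.
Proof.
rewrite raddf_sum mulmx_sum_row; apply: eq_bigr => j _.
by rewrite coZ rowK mxE.
Qed.

Lemma unit_coord_independent b : coord_mx b \in unitmx -> independent s b.
Proof.
move=> b_unit c /(congr1 co); rewrite coord_sum raddf0.
move/(canRL (mulmxK b_unit)); rewrite mul0mx => /rowP c0 j.
by have := c0 j; rewrite !mxE.
Qed.

Hypothesis co_inj : injective co.

Lemma unit_coord_spanning b : coord_mx b \in unitmx -> spanning s b.
Proof.
move=> b_unit x; exists (fun j => (co x *m invmx (coord_mx b)) 0 j).
apply: co_inj; rewrite coord_sum -[LHS](mulmxKV b_unit); congr (_ *m _).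
by apply/rowP => j; rewrite [RHS]mxE.
Qed.

Lemma independent_unit_coord b : independent s b -> coord_mx b \in unitmx.
Proof.
move=> b_ind; rewrite unitmxE unitfE; apply/det0P => -[v v0 vb0].
case/eqP: v0; apply/rowP => j; rewrite [RHS]mxE.
apply: (b_ind (fun j => v 0 j)); apply: co_inj.
rewrite coord_sum raddf0 -[RHS]vb0; congr (_ *m _).
by apply/rowP => l; rewrite mxE.
Qed.

End Coordinates.

Lemma prod_sumE (I : Type) (A : I -> pzRingType) (J : finType)
    (x : J -> prodring A) i : (\sum_j x j) i = \sum_j x j i.
Proof.
by apply: (big_morph (fun y : prodring A => y i)).
Qed.

Section Blocks.
Variables (q : nat) (n d : 'I_q -> nat).

(** The position of a coefficient in either algebra: the index of the block,
    the entry of the matrix, and either the index of the copy or the power of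
    the class of the variable. *)
Definition position : finType :=
  {i : 'I_q & ('I_(n i) * 'I_(n i) * 'I_(d i))%type}.

Local Notation scalarW F := (@wedderburn_scalar F q n d).

Lemma card_position : #|position| = (\sum_(i < q) n i ^ 2 * d i)%N.
Proof.
rewrite card_tagged sumnE big_map big_enum /=; apply: eq_bigr => i _.
by rewrite !card_prod !card_ord expnS expn1.
Qed.

Section Wedderburn.
Variable F : fieldType.
Local Notation W := (wedderburn F n d).

Fact wedderburn_scalar_zmod : zmod_morphism (scalarW F).
Proof.
move=> a b; apply: functional_extensionality_dep => i.
apply: functional_extensionality_dep => j.
by rewrite /wedderburn_scalar raddfB.
Qed.
Fact wedderburn_scalar_monoid : monoid_morphism (scalarW F).
Proof.
split=> [//|a b]; apply: functional_extensionality_dep => i.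
apply: functional_extensionality_dep => j.
by rewrite /wedderburn_scalar scalar_mxM.
Qed.
HB.instance Definition _ := GRing.isZmodMorphism.Build F W
  (scalarW F) wedderburn_scalar_zmod.
HB.instance Definition _ := GRing.isMonoidMorphism.Build F W
  (scalarW F) wedderburn_scalar_monoid.

Lemma wedderburn_scalarC c (w : W) :
  scalarW F c * w = w * scalarW F c.
Proof.
apply: functional_extensionality_dep => i.
by apply: functional_extensionality_dep => j; exact: comm_scalar_mx.
Qed.

Lemma wedderburn_scalarE c (w : W) i j r s :
  (scalarW F c * w) i j r s = c * w i j r s.
Proof. by rewrite [LHS](_ : _ = (c%:M *m w i j) r s) // mul_scalar_mx mxE. Qed.

Definition wedderburn_coef (w : W) (t : position) : F :=
  w (tag t) (tagged t).2 (tagged t).1.1 (tagged t).1.2.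
Definition wedderburn_coord (w : W) : 'rV[F]_#|position| :=
  \row_l wedderburn_coef w (enum_val l).

Fact wedderburn_coord_zmod : zmod_morphism wedderburn_coord.
Proof.
move=> v w; apply/rowP => l; rewrite !mxE; set t := enum_val l.
transitivity ((v (tag t) (tagged t).2 - w (tag t) (tagged t).2)
  (tagged t).1.1 (tagged t).1.2) => //.
by rewrite !mxE.
Qed.
HB.instance Definition _ := GRing.isZmodMorphism.Build W 'rV[F]_#|position|
  wedderburn_coord wedderburn_coord_zmod.

Lemma wedderburn_coordZ c w :
  wedderburn_coord (scalarW F c * w) = c *: wedderburn_coord w.
Proof.
by apply/rowP => l; rewrite !mxE [LHS]wedderburn_scalarE.
Qed.

Lemma wedderburn_coord_inj : injective wedderburn_coord.
Proof.
move=> v w vw; apply: functional_extensionality_dep => i.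
apply: functional_extensionality_dep => j; apply/matrixP => r s.
pose t : position := Tagged _ (r, s, j).
by have /rowP/(_ (enum_rank t)) := vw; rewrite !mxE enum_rankK.
Qed.

End Wedderburn.

(** A square matrix invertible over [F] stays so over [K]. That [w] spans over
    [F] already follows from the number of its elements. *)
Lemma wedderburn_extend_basis (F K : fieldType) (iota : {rmorphism F -> K})
    (w : 'I_#|position| -> wedderburn F n d) :
    independent (scalarW F) w ->
  let w' := fun l i j => map_mx iota (w l i j) : 'M_(n i) in
  spanning (scalarW K) w' /\
  independent (scalarW K) w'.
Proof.
move=> w_ind w'.
have w_unit : coord_mx (@wedderburn_coord F) w \in unitmx.
  by apply: independent_unit_coord w_ind;
    [exact: wedderburn_coordZ | exact: wedderburn_coord_inj].
have w'_unit : coord_mx (@wedderburn_coord K) w' \in unitmx.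
  suff -> : coord_mx (@wedderburn_coord K) w' =
      map_mx iota (coord_mx (@wedderburn_coord F) w) by rewrite map_unitmx.
  by apply/matrixP => j l; rewrite !mxE [LHS]mxE.
split.
  apply: unit_coord_spanning w'_unit => //;
    [exact: wedderburn_coordZ | exact: wedderburn_coord_inj].
by apply: unit_coord_independent w'_unit; exact: wedderburn_coordZ.
Qed.

Section MatrixAlgebra.
Variables (k : fieldType) (g : 'I_q -> {poly {poly k}}).
Hypothesis d_gt0 : forall i, (0 < d i)%N.
Hypothesis g_monic : forall i, g i \is monic.
Hypothesis g_size : forall i, size (g i) = (d i).+1.

Local Notation L := (laurent k).
Local Notation A' := (matalg n g).
Local Notation h i := (laurent_poly (g i)).

Lemma laurent_poly_map i :
  h i = map_poly (fps_laurent k \o @fps_of_poly k) (g i).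
Proof. by []. Qed.

Lemma laurent_poly_monic i : h i \is monic.
Proof. by rewrite laurent_poly_map; apply: monic_map. Qed.

Lemma size_laurent_poly i : size (h i) = (d i).+1.
Proof.
rewrite laurent_poly_map size_map_poly_id0 //.
by rewrite (monicP (g_monic i)) rmorph1 oner_neq0.
Qed.

Lemma mk_monic_laurent_poly i : mk_monic (h i) = h i.
Proof.
by rewrite /mk_monic size_laurent_poly ltnS d_gt0 laurent_poly_monic.
Qed.

Lemma size_residue i (p : {poly %/ h i}) : (size p <= d i)%N.
Proof.
have size_h : size (mk_monic (h i)) = (d i).+1.
  by rewrite mk_monic_laurent_poly size_laurent_poly.
by rewrite -ltnS -size_h; apply: size_mk_monic.
Qed.

(** The powers of the class of the variable below [d i] are already reduced, so
    the coefficients of such a combination are those of its reduced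
    representative. *)
Lemma coef_power_sum i (c : 'I_(d i) -> L) (j : 'I_(d i)) :
  ((\sum_m c m *: 'qX ^+ m : {poly %/ h i}) : {poly L})`_j = c j.
Proof.
have -> : \sum_m c m *: ('qX : {poly %/ h i}) ^+ m =
          in_qpoly (h i) (\sum_m c m *: 'X^m).
  rewrite raddf_sum; apply: eq_bigr => m _.
  by rewrite [RHS]in_qpolyZ rmorphXn.
have sum_poly : \sum_m c m *: 'X^m = \poly_(m < d i) oapp c 0 (insub m).
  by rewrite poly_def; apply: eq_bigr => m _; rewrite valK.
rewrite sum_poly in_qpoly_small; first by rewrite coef_poly ltn_ord valK.
by rewrite mk_monic_laurent_poly size_laurent_poly ltnS size_poly.
Qed.

Lemma matalg_scalarE c (a : A') i r s :
  (matalg_scalar n g c * a) i r s = c *: a i r s.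
Proof.
rewrite [LHS](_ : _ = ((c%:A)%:M *m a i) r s) //.
by rewrite mul_scalar_mx mxE -scalerAl mul1r.
Qed.

Definition matalg_coef (a : A') (t : position) : L :=
  (a (tag t) (tagged t).1.1 (tagged t).1.2 : {poly L})`_(tagged t).2.
Definition matalg_coord (a : A') : 'rV[L]_#|position| :=
  \row_l matalg_coef a (enum_val l).

Fact matalg_coord_zmod : zmod_morphism matalg_coord.
Proof.
move=> a b; apply/rowP => l; rewrite !mxE; set t := enum_val l.
transitivity (((a (tag t) - b (tag t)) (tagged t).1.1 (tagged t).1.2
  : {poly L})`_(tagged t).2) => //.
by rewrite !mxE coefB.
Qed.
HB.instance Definition _ := GRing.isZmodMorphism.Build A' 'rV[L]_#|position|
  matalg_coord matalg_coord_zmod.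

Lemma matalg_coordZ c a :
  matalg_coord (matalg_scalar n g c * a) = c *: matalg_coord a.
Proof.
by apply/rowP => l; rewrite !mxE /matalg_coef matalg_scalarE coefZ.
Qed.

Lemma matalg_coord_inj : injective matalg_coord.
Proof.
move=> a b ab; apply: functional_extensionality_dep => i.
apply/matrixP => r s; apply: val_inj; apply/polyP => j.
have [lt_jd|le_dj] := ltnP j (d i); last first.
  by rewrite !nth_default // (leq_trans (size_residue _)).
pose t : position := Tagged _ (r, s, Ordinal lt_jd).
by have /rowP/(_ (enum_rank t)) := ab; rewrite !mxE enum_rankK.
Qed.

(** This turns the bound on the image into the integrality of coordinates, which
    makes the image a submodule of a free module over [fps k]. *)
Lemma matalg_coord_fps a : in_M_fps d a ->
  exists v : 'rV[fps k]_#|position|, map_mx (fps_laurent k) v = matalg_coord a.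
Proof.
move=> Ma.
have /choice[v vP] (l : 'I_#|position|) :
    exists x : fps k, fps_laurent k x = matalg_coord a 0 l.
  rewrite mxE; move: (enum_val l) => t.
  have [c [c_fps ac]] := Ma (tag t) (tagged t).1.1 (tagged t).1.2.
  have [x xc] := c_fps (tagged t).2; exists x; rewrite xc -(coef_power_sum c).
  exact: (congr1 (fun p : {poly %/ h _} => (p : {poly L})`_(tagged t).2) (esym ac)).
by exists (\row_l v l); apply/rowP => l; rewrite mxE mxE vP.
Qed.

Lemma matalg_nontrivial : (0 < #|position|)%N -> (1 : A') != 0.
Proof.
move=> /card_gt0P[t _]; apply/eqP => /(congr1 (fun a : A' => a (tag t))).
move/matrixP/(_ (tagged t).1.1 (tagged t).1.1).
by rewrite !mxE eqxx => /eqP; rewrite oner_eq0.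
Qed.

Section Evaluation.
Variables (K : fieldType) (iota : {rmorphism L -> K}).
Variable z : forall i, 'I_(d i) -> K.
Arguments z : clear implicits.
Hypothesis z_root : forall i j, root (map_poly iota (h i)) (z i j).

(** The value at a root is computed on the reduced representative; reduction
    modulo [h i] does not change it. *)
Definition residue_eval i (j : 'I_(d i)) (p : {poly %/ h i}) : K :=
  (map_poly iota (p : {poly L})).[z i j].

Section Residue.
Variables (i : 'I_q) (j : 'I_(d i)).

Fact residue_eval_zmod : zmod_morphism (residue_eval j).
Proof. by move=> a b; rewrite /residue_eval /= !rmorphB hornerD hornerN. Qed.
Fact residue_eval_monoid : monoid_morphism (residue_eval j).
Proof.
split=> [|a b]; first by rewrite /residue_eval /= rmorph1 hornerC.
rewrite /residue_eval poly_of_qpolyM; move: (polyn a) (polyn b) => {}a {}b.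
rewrite mk_monic_laurent_poly -hornerM -rmorphM.
rewrite [in RHS](Pdiv.RingMonic.rdivp_eq (laurent_poly_monic i) (a * b)).
by rewrite rmorphD rmorphM hornerD hornerM (rootP (z_root j)) mulr0 add0r.
Qed.
HB.instance Definition _ := GRing.isZmodMorphism.Build {poly %/ h i} K
  (residue_eval j) residue_eval_zmod.
HB.instance Definition _ := GRing.isMonoidMorphism.Build {poly %/ h i} K
  (residue_eval j) residue_eval_monoid.

Lemma residue_evalZ c p : residue_eval j (c *: p) = iota c * residue_eval j p.
Proof. by rewrite /residue_eval /= map_polyZ hornerZ. Qed.
End Residue.

Definition block_eval (a : A') : wedderburn K n d :=
  fun i j => map_mx (residue_eval j) (a i).

Fact block_eval_zmod : zmod_morphism block_eval.
Proof.
move=> a b; apply: functional_extensionality_dep => i.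
by apply: functional_extensionality_dep => j; apply: map_mxB.
Qed.
Fact block_eval_monoid : monoid_morphism block_eval.
Proof.
split=> [|a b]; apply: functional_extensionality_dep => i;
  apply: functional_extensionality_dep => j.
  exact: map_mx1.
exact: map_mxM.
Qed.

Lemma block_eval_scalar c :
  block_eval (matalg_scalar n g c) = scalarW K (iota c).
Proof.
apply: functional_extensionality_dep => i.
apply: functional_extensionality_dep => j.
rewrite /block_eval /wedderburn_scalar map_scalar_mx; congr (_%:M).
by rewrite [LHS]residue_evalZ rmorph1 mulr1.
Qed.

Hypothesis z_inj : forall i, injective (z i).

(** A relation over [K] between the images says that a combination of the
    polynomials found at each entry, which has degree less than [d i], vanishes at
    the [d i] distinct points [z i j]. So the combination is zero, and this is
    a relation between the rows of the coordinate matrix of [b], extended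
    to [K]. *)
Lemma block_eval_independent (b : 'I_#|position| -> A') :
    coord_mx matalg_coord b \in unitmx ->
  independent (scalarW K) (block_eval \o b).
Proof.
move=> b_unit c c0.
suff: (\row_l c l) *m map_mx iota (coord_mx matalg_coord b) = 0.
  rewrite -(map_unitmx iota) in b_unit.
  move/(canRL (mulmxK b_unit)); rewrite mul0mx => /rowP cl j.
  by have := cl j; rewrite !mxE.
apply/rowP => m; rewrite !mxE.
under eq_bigr do rewrite !mxE.
case: (enum_val m) => i [[r s] j] {m}; rewrite /matalg_coef /=.
pose p := \sum_l c l *: map_poly iota (b l i r s : {poly L}).
suff p0 : p = 0.
  transitivity p`_j; last by rewrite p0 coef0.
  by rewrite coef_sum; apply: eq_bigr => l _; rewrite coefZ coef_map.
have size_p : (size p <= d i)%N.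
  apply: (leq_trans (size_sum _ _ _)); apply/bigmax_leqP => l _.
  apply: leq_trans (size_scale_leq _ _) _.
  exact: leq_trans (size_poly _ _) (size_residue _).
apply/eqP; apply: contraTT size_p => p_neq0; rewrite -ltnNge.
rewrite -[d i]card_ord -(size_codom (z i)); apply: max_poly_roots => //.
  apply/allP => _ /codomP[j' ->]; apply/rootP; rewrite horner_sum.
  have /(congr1 (fun w : wedderburn K n d => w i j' r s)) := c0.
  rewrite !prod_sumE summxE [RHS]mxE => zero; rewrite -[RHS]zero.
  by apply: eq_bigr => l _; rewrite hornerZ wedderburn_scalarE /= mxE.
by apply/injectiveP; apply: z_inj.
Qed.

End Evaluation.

End MatrixAlgebra.

End Blocks.

(** * The image of a morphism as an algebra *)

(** The hypothesis that the target is not the zero ring is an argument of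
    [image_alg], so that the instances below can refer to it. *)
Section ImageAlgebra.
Variables (R : comNzRingType) (P : algType R) (D : pzRingType).
Variable f : {rmorphism P -> D}.
Hypothesis D_nontrivial : (1 : D) != 0.

Lemma to_imringM a b : to_imring f (a * b) = to_imring f a * to_imring f b.
Proof. by apply: val_inj; rewrite /= rmorphM. Qed.
Lemma to_imringD a b : to_imring f (a + b) = to_imring f a + to_imring f b.
Proof. by apply: val_inj; rewrite /= rmorphD. Qed.
Lemma to_imring1 : to_imring f 1 = 1.
Proof. by apply: val_inj; rewrite /= rmorph1. Qed.

Definition image_scale (c : R) (x : imring f) : imring f := to_imring f c%:A * x.

Fact image_oner_neq0 : (1 : imring f) != 0.
Proof. by apply: contra D_nontrivial => /eqP/(congr1 val) /= ->. Qed.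
Fact image_scaleA a b x : image_scale a (image_scale b x) = image_scale (a * b) x.
Proof. by rewrite /image_scale mulrA -to_imringM -scalerAl mul1r scalerA. Qed.
Fact image_scale1 : left_id 1 image_scale.
Proof. by move=> x; rewrite /image_scale scale1r to_imring1 mul1r. Qed.
Fact image_scaleDr : right_distributive image_scale +%R.
Proof. by move=> a x y; rewrite /image_scale mulrDr. Qed.
Fact image_scaleDl x : {morph image_scale^~ x : a b / a + b}.
Proof. by move=> a b; rewrite /image_scale -mulrDl -to_imringD scalerDl. Qed.
Fact image_scaleAl a x y : image_scale a (x * y) = image_scale a x * y.
Proof. exact: mulrA. Qed.
Fact image_scaleAr a x y : image_scale a (x * y) = x * image_scale a y.
Proof.
rewrite /image_scale !mulrA; congr (_ * _).
by apply: to_imring_central => b; apply: in_alg_central.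
Qed.

Definition image_alg of (1 : D) != 0 : Type := imring f.
Local Notation B := (image_alg D_nontrivial).
HB.instance Definition _ := GRing.PzRing.copy B (imring f).
HB.instance Definition _ := GRing.PzSemiRing_isNonZero.Build B image_oner_neq0.
HB.instance Definition _ := GRing.Zmodule_isLmodule.Build R B
  image_scaleA image_scale1 image_scaleDr image_scaleDl.
HB.instance Definition _ := GRing.Lmodule_isLalgebra.Build R B image_scaleAl.
HB.instance Definition _ := GRing.Lalgebra_isAlgebra.Build R B image_scaleAr.

End ImageAlgebra.

(** In [image_alg] the scalar t is the image of the scalar t of the free
    algebra, so the two quotients by t have the same ideal. *)
Lemma image_special_fiber (k : fieldType) (rho : nat) (D : pzRingType)
    (f : {rmorphism free_alg k rho -> D}) (D_nontrivial : (1 : D) != 0)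
    (N : algType k) :
    alg_iso (@imring_scalar k rho D f) (fun c : k => c%:A : N) ->
  alg_iso (fun c : k => c%:A : N) (@special_scalar k (image_alg f D_nontrivial)).
Proof.
case=> phi [phi_bij phi_scalar]; apply: alg_iso_sym.
pose J := central_ideal (to_imring_central (f := f)
  (in_alg_central (B := free_alg k rho) (fpsX k))).
have algE (c : fps k) : c%:A = to_imring f c%:A :> image_alg f D_nontrivial.
  exact: mulr1.
pose theta : {rmorphism imring f -> N} := phi \o quot_proj J.
have theta0 x : theta x = 0 <-> J x.
  split=> [x0|Jx].
    rewrite -[x]subr0; apply/(Defs.quotP J)/eqP/(bij_inj phi_bij).
    exact: etrans x0 (esym (rmorph0 theta)).
  have -> : theta x = theta 0; last exact: rmorph0.
  by congr (phi _); apply/eqP/(Defs.quotP J); rewrite subr0.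
apply: (@quot_iso _ _ _ _ _ _ theta) => [x|y|c].
- apply: iff_trans (iff_sym (theta0 x)); rewrite /= /mulset.
  by rewrite algE.
- have [psi _ psiK] := phi_bij; exists (repr (psi y)).
  by rewrite /theta /= /quot_proj reprK.
- exists (to_imring f (fpsC c)%:A); last exact: phi_scalar.
  by congr (quot_proj _ _); apply: algE.
Qed.

Lemma free_module_basis (R : nzRingType) (V : lmodType R) (n : nat) (b : 'I_n -> V) :
    (forall x, exists c : 'I_n -> R, x = \sum_j c j *: b j) ->
    (forall c : 'I_n -> R, \sum_j c j *: b j = 0 -> forall j, c j = 0) ->
  free_module V.
Proof.
move=> b_span b_free; exists 'I_n.
pose phi (x : {malg R['I_n]}) := \sum_j x@_j *: b j.
have phi_lin : linear phi.
  move=> c x y; rewrite /phi scaler_sumr -big_split /=; apply: eq_bigr => j _.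
  by rewrite mcoeffD mcoeffZ scalerDl scalerA.
pose phiL : {linear {malg R['I_n]} -> V} :=
  HB.pack phi (GRing.isLinear.Build R _ V _ phi phi_lin).
exists phiL; apply: inj_surj_bijective => [x y|v].
  move=> xy; apply/malgP => j; apply/eqP; rewrite -subr_eq0 -mcoeffB; apply/eqP.
  move: j; apply: b_free; rewrite -/(phi (x - y)).
  by apply: etrans (raddfB phiL x y) _; apply/eqP; rewrite subr_eq0; apply/eqP/xy.
have [c ->] := b_span v; exists (\sum_j << c j *g j >>).
apply: eq_bigr => j _; congr (_ *: _).
rewrite raddf_sum (bigD1 j) //= mcoeffUU big1 ?addr0 // => i ij.
by rewrite mcoeffU (negPf ij).
Qed.

(** * The lattice of the image and the two generic fibers *)

Lemma fps_laurent_eq0 (k : idomainType) (x : fps k) : (fps_laurent k x == 0) = (x == 0).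
Proof. exact: tofrac_eq0. Qed.

Lemma laurentT_neq0 (k : idomainType) : laurentT k != 0.
Proof.
rewrite fps_laurent_eq0; apply/eqP => /(congr1 (fun x => fps_coef x 1)) /eqP.
by rewrite /= coefX oner_eq0.
Qed.

Section BoundedImage.
Variables (k : fieldType) (q : nat) (n d : 'I_q -> nat).
Variable g : 'I_q -> {poly {poly k}}.
Hypothesis d_gt0 : forall i, (0 < d i)%N.
Hypothesis g_monic : forall i, g i \is monic.
Hypothesis g_size : forall i, size (g i) = (d i).+1.

Local Notation A' := (matalg n g).
Local Notation N := #|position n d|.
Local Notation scalar := (matalg_scalar n g).
Local Notation fl := (fps_laurent k).

Variables (P : algType (fps k)) (f : {rmorphism P -> A'}).
Hypothesis fZ : forall c p, f (c *: p) = scalar (fl c) * f p.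
Variable gamma : nat.
Hypothesis f_bounded : forall p, exists2 m, in_M_fps d m &
  f p = scalar (laurentT k ^- gamma) * m.
Variable m : 'I_N -> P.
Hypothesis f_free : independent (scalar \o fl) (f \o m).

Local Notation tg := (laurentT k ^- gamma).

(** The [p j] are preimages of generators of the image. Their coordinates form
    the matrix [G], up to the factor t^(-gamma). The coordinates of the
    independent elements [f (m j)] form a multiple of [G], with a nonzero
    determinant, since a relation over [fps k] between them would be one between
    the [f (m j)]; so the determinant of [G] is nonzero. *)
Lemma bounded_image_basis : exists p : 'I_N -> P,
  (forall x, exists c : 'I_N -> fps k, f x = \sum_j scalar (fl (c j)) * f (p j)) /\
  coord_mx (@matalg_coord q n d k g) (f \o p) \in unitmx.
Proof.
have tg0 : tg != 0 by rewrite invr_eq0 expf_neq0 ?laurentT_neq0.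
pose lattice p (v : 'rV[fps k]_N) := matalg_coord d (f p) = tg *: map_mx fl v.
have latticeP p : exists v, lattice p v.
  have [a Ma fp] := f_bounded p.
  have [v va] := matalg_coord_fps d_gt0 g_monic g_size Ma.
  by exists v; rewrite /lattice fp va -matalg_coordZ.
have [||a v [p pv]|G /choice[p pG] G_span] :=
  @fps_submodule_span _ _ (fun v => exists p, lattice p v).
- by exists 0; rewrite /lattice !raddf0.
- move=> v w [p pv] [r rw]; exists (p - r).
  by rewrite /lattice rmorphB raddfB /= pv rw map_mxB scalerBr.
- exists (a *: p).
  by rewrite /lattice fZ matalg_coordZ pv map_mxZ !scalerA mulrC.
exists p.
have coord_p : coord_mx (@matalg_coord q n d k g) (f \o p) = tg *: map_mx fl G.
  by apply/row_matrixP => j; rewrite rowK linearZ /= -map_row; apply: pG.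
have lattice_span x v : lattice x v -> exists c : 'rV_N, v = c *m G.
  by move=> xv; apply: G_span; exists x.
split=> [x|].
  have [v xv] := latticeP x; have [c vc] := lattice_span x v xv.
  exists (fun j => c 0 j); apply: (matalg_coord_inj d_gt0 g_monic g_size).
  have /= -> := coord_sum (@matalg_coordZ _ n d _ g) (f \o p) (fun j => fl (c 0 j)).
  rewrite coord_p -scalemxAr xv vc map_mxM; congr (_ *: (_ *m _)).
  by apply/rowP => j; rewrite !mxE.
have /choice[v mv] j := latticeP (m j).
have /choice[C vC] j := lattice_span _ _ (mv j).
have detG : \det G != 0.
  have: \det (\matrix_j v j) != 0.
    apply/det0P => -[u u0 uv]; case/eqP: u0; apply/rowP => j; rewrite [RHS]mxE.
    apply: (f_free (c := fun j => u 0 j)).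
    apply: (matalg_coord_inj d_gt0 g_monic g_size).
    have /= -> := coord_sum (@matalg_coordZ _ n d _ g) (f \o m) (fun j => fl (u 0 j)).
    have -> : coord_mx (@matalg_coord q n d k g) (f \o m) =
        tg *: map_mx fl (\matrix_j v j).
      by apply/row_matrixP => i; rewrite rowK linearZ /= -map_row rowK; apply: mv.
    have -> : \row_j fl (u 0 j) = map_mx fl u by apply/rowP => i; rewrite !mxE.
    by rewrite -scalemxAr -map_mxM uv !raddf0.
  have -> : \matrix_j v j = \matrix_j C j *m G.
    by apply/row_matrixP => j; rewrite rowK row_mul rowK vC.
  by rewrite det_mulmx mulf_eq0 negb_or => /andP[].
rewrite coord_p unitmxE unitfE detZ det_map_mx mulf_eq0 negb_or.
by rewrite fps_laurent_eq0 detG andbT; apply: expf_neq0.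
Qed.

End BoundedImage.

Section Fibers.
Variables (k : fieldType) (K : closedFieldType) (iota : {rmorphism laurent k -> K}).
Variables (q : nat) (n d : 'I_q -> nat).

(** The Wedderburn isomorphism carries a basis of [A] to a basis of the split
    algebra over [k], which remains a basis over [K]. *)
Lemma wedderburn_tensor (A : falgType k) :
    \dim {:A} = #|position n d| ->
    alg_iso (fun c : k => c%:A : A) (@wedderburn_scalar k q n d) ->
  alg_iso (@tens_scalar _ _ (const_closure iota) A) (@wedderburn_scalar K q n d).
Proof.
move=> dimA [phi [phi_bij phi_scalar]].
pose b (j : 'I_#|position n d|) : A := (vbasis {:A})`_j.
have phiZ c x : phi (c *: x) = @wedderburn_scalar k q n d c * phi x.
  by rewrite -[x in LHS]mul1r scalerAl rmorphM phi_scalar.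
have b_span : spanning (fun c : k => c%:A : A) b.
  move=> x; have := coord_vbasis (memvf x); move: (coord _) => co.
  rewrite /b; move: (vbasis _) co; rewrite dimA => X co ->.
  by exists (fun j => co j x); apply: eq_bigr => j _; rewrite -scalerAl mul1r.
have b_ind : independent (@wedderburn_scalar k q n d) (phi \o b).
  move=> c c0; have: \sum_j c j *: b j = 0.
    apply: (bij_inj phi_bij); rewrite rmorph0 -[RHS]c0 rmorph_sum.
    by apply: eq_bigr => j _; rewrite phiZ.
  have := basis_free (vbasisP {:A}); rewrite /b.
  by move: (vbasis _); rewrite dimA => X /freeP X_free /X_free.
have [b'_span b'_ind] := wedderburn_extend_basis (const_closure iota) b_ind.
pose psi_fun (x : A) : wedderburn K n d :=
  fun i j => map_mx (const_closure iota) (phi x i j).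
have psi_zmod : zmod_morphism psi_fun.
  move=> x y; apply: functional_extensionality_dep => i.
  apply: functional_extensionality_dep => j.
  by rewrite /psi_fun rmorphB [LHS]map_mxB.
have psi_monoid : monoid_morphism psi_fun.
  split=> [|x y]; apply: functional_extensionality_dep => i;
    apply: functional_extensionality_dep => j.
    by rewrite /psi_fun rmorph1 [LHS]map_mx1.
  by rewrite /psi_fun rmorphM [LHS]map_mxM.
apply: (@tensor_iso _ _ _ _ _ _ (to_rmorph psi_zmod psi_monoid) _ b) => //.
- exact: wedderburn_scalarC.
- move=> c x; apply: functional_extensionality_dep => i.
  apply: functional_extensionality_dep => j.
  by rewrite /= /rmorph_fun /psi_fun phiZ [LHS]map_mxM /= map_scalar_mx.
Qed.

Variable g : 'I_q -> {poly {poly k}}.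
Hypothesis d_gt0 : forall i, (0 < d i)%N.
Hypothesis g_monic : forall i, g i \is monic.
Hypothesis g_size : forall i, size (g i) = (d i).+1.

(** The roots are indexed by ['I_(d i)] like the copies of the i-th matrix
    algebra in the Wedderburn decomposition. *)
Lemma distinct_roots :
    (forall i (z : K), (mup z (map_poly iota (laurent_poly (g i))) <= 1)%N) ->
  exists z : forall i, 'I_(d i) -> K,
    (forall i j, root (map_poly iota (laurent_poly (g i))) (z i j)) /\
    (forall i, injective (z i)).
Proof.
move=> g_simple.
pose h i := map_poly iota (laurent_poly (g i)).
have h_monic i : h i \is monic by rewrite map_monic laurent_poly_monic.
have h_size i : size (h i) = (d i).+1.
  by rewrite size_map_poly (size_laurent_poly g_monic g_size).
have /choice[r rP] i : exists r : seq K, h i = \prod_(z <- r) ('X - z%:P).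
  have [r hr] := closed_field_poly_normal (h i); exists r.
  by rewrite hr (monicP (h_monic i)) scale1r.
have r_size i : size (r i) = d i.
  by have := h_size i; rewrite rP size_prod_XsubC => -[].
have r_uniq i : uniq (r i).
  apply: count_mem_uniq => z; have := g_simple i z.
  rewrite -/(h i) rP mu_prod_XsubC; case: (posnP (count_mem z (r i))) => [c0|c_gt0].
    by move=> _; rewrite c0 -has_pred1 has_count c0.
  move=> c_le1; have -> : count_mem z (r i) = 1%N by apply/eqP; rewrite eqn_leq c_le1.
  by rewrite -has_pred1 has_count c_gt0.
exists (fun i j => (r i)`_j); split=> [i j|i j j'].
  by rewrite -/(h i) rP root_prod_XsubC mem_nth ?r_size.
by move/eqP; rewrite nth_uniq ?r_size // => /eqP/val_inj.
Qed.

End Fibers.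

Section GenericFiber.
Variables (k : fieldType) (K : closedFieldType) (iota : {rmorphism laurent k -> K}).
Variables (q : nat) (n d : 'I_q -> nat) (g : 'I_q -> {poly {poly k}}).
Hypothesis d_gt0 : forall i, (0 < d i)%N.
Hypothesis g_monic : forall i, g i \is monic.
Hypothesis g_size : forall i, size (g i) = (d i).+1.
Hypothesis g_simple_roots : forall i (z : K),
  (mup z (map_poly iota (laurent_poly (g i))) <= 1)%N.

Local Notation A' := (matalg n g).
Local Notation scalar := (matalg_scalar n g).
Local Notation scalarK := (@wedderburn_scalar K q n d).
Local Notation fl := (fps_laurent k).

Variables (P : algType (fps k)) (f : {rmorphism P -> A'}).
Hypothesis fZ : forall c p, f (c *: p) = scalar (fl c) * f p.
Hypothesis A'_nontrivial : (1 : A') != 0.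
Local Notation D := (image_alg f A'_nontrivial).

Variable p : 'I_#|position n d| -> P.
Hypothesis p_span : forall x, exists c : 'I_#|position n d| -> fps k,
  f x = \sum_j scalar (fl (c j)) * f (p j).
Hypothesis p_unit : coord_mx (@matalg_coord q n d k g) (f \o p) \in unitmx.

Definition image_gen j : D := to_imring f (p j).

Fact imring_val_zmod : zmod_morphism (@imring_val P A' f : D -> A').
Proof. exact: (raddfB (\val : imring f -> A')). Qed.
Fact imring_val_monoid : monoid_morphism (@imring_val P A' f : D -> A').
Proof.
by split; [apply: (rmorph1 (\val : imring f -> A'))
         | apply: (rmorphM (\val : imring f -> A'))].
Qed.
Definition image_val : {rmorphism D -> A'} :=
  to_rmorph imring_val_zmod imring_val_monoid.

Lemma image_valZ c x : image_val (c *: x) = scalar (fl c) * image_val x.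
Proof.
apply: etrans (imring_val_monoid.2 (to_imring f c%:A) x) _.
by congr (_ * _); rewrite /= fZ rmorph1 mulr1.
Qed.

Lemma image_val_inj : injective image_val.
Proof. exact: (val_inj : injective (\val : imring f -> A')). Qed.

Lemma image_gen_span : spanning (fun c : fps k => c%:A : D) image_gen.
Proof.
move=> x; have /asboolP[y yx] := imring_valP x.
have [c yc] := p_span y; exists c; apply: image_val_inj.
rewrite rmorph_sum -[LHS]/(imring_val x) -yx yc; apply: eq_bigr => j _.
by rewrite -scalerAl mul1r image_valZ.
Qed.

Lemma image_free_module : free_module D.
Proof.
apply: (@free_module_basis _ _ _ image_gen) => [x|c c0 j].
  have [c ->] := image_gen_span x; exists c.
  by apply: eq_bigr => j _; rewrite -scalerAl mul1r.
apply/eqP; rewrite -fps_laurent_eq0; apply/eqP; move: j.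
apply: (unit_coord_independent (@matalg_coordZ _ n d _ g) p_unit
  (c := fun j => fl (c j))).
rewrite -[RHS](rmorph0 image_val) -c0 rmorph_sum; apply: eq_bigr => j _.
by rewrite image_valZ.
Qed.

(** The basis [image_gen] of [D] over the power series is a basis of [A'] over
    the Laurent series, and evaluation at the roots makes it a basis over [K]. *)
Lemma image_tensor : alg_iso (@tens_scalar _ _ (fps_closure iota) D) scalarK.
Proof.
have [z [z_root z_inj]] := distinct_roots g_monic g_size g_simple_roots.
pose ev : {rmorphism A' -> wedderburn K n d} := to_rmorph
  (@block_eval_zmod _ n _ _ _ _ iota z)
  (block_eval_monoid n d_gt0 g_monic g_size z_root).
pose psi : {rmorphism D -> wedderburn K n d} := ev \o image_val.
have psi_unit : coord_mx (@wedderburn_coord q n d K) (psi \o image_gen) \in unitmx.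
  apply: independent_unit_coord; first exact: wedderburn_coordZ.
    exact: wedderburn_coord_inj.
  exact: (block_eval_independent d_gt0 g_monic g_size z_inj p_unit).
apply: (@tensor_iso _ _ _ _ _ _ psi _ image_gen).
- exact: wedderburn_scalarC.
- move=> c x; apply: etrans (congr1 ev (image_valZ c x)) _.
  by rewrite rmorphM; congr (_ * _); apply: block_eval_scalar.
- exact: image_gen_span.
- by apply: unit_coord_spanning psi_unit; [exact: wedderburn_coordZ
    | exact: wedderburn_coord_inj].
- by apply: unit_coord_independent psi_unit; exact: wedderburn_coordZ.
Qed.

End GenericFiber.

Theorem corollary28
  (R : realType)
  (* an algebraic closure K of the field of Laurent series *)
  (K : closedFieldType) (iota : {rmorphism laurent R[i] -> K})
  (K_closure : is_alg_closure iota)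
  (* the algebras N and A *)
  (n : nat) (N A : falgType R[i])
  (dimN : \dim {:N} = n) (dimA : \dim {:A} = n) (A_semisimple : semisimple A)
  (* a Wedderburn decomposition of A *)
  (k' : nat) (k'_gt0 : (0 < k')%N) (ni di : 'I_k' -> nat)
  (ni_gt0 : forall i, (0 < ni i)%N) (di_gt0 : forall i, (0 < di i)%N)
  (sum_n : n = (\sum_(i < k') ni i ^ 2 * di i)%N)
  (A_wedderburn :
    alg_iso (fun c : R[i] => c%:A : A) (@wedderburn_scalar R[i] k' ni di))
  (* the polynomials g_i *)
  (g : 'I_k' -> {poly {poly R[i]}})
  (g_monic : forall i, g i \is monic)
  (g_deg : forall i, size (g i) = (di i).+1)
  (g_simple_roots : forall i (z : K),
    (mup z (map_poly iota (laurent_poly (g i))) <= 1)%N)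
  (* the homomorphism f *)
  (rho : nat) (f : {rmorphism free_alg R[i] rho -> matalg ni g})
  (f_linear : fps_linear (@matalg_scalar R[i] k' ni g) f)
  (f_var : forall j : 'I_rho, in_M_laurent di (f (free_var R[i] j)))
  (f_free : exists m : 'I_n -> free_alg R[i] rho,
    (forall j, const_coefs (m j)) /\
    forall c : 'I_n -> fps R[i],
      \sum_(j < n) matalg_scalar ni g (fps_laurent R[i] (c j)) * f (m j) = 0 ->
      forall j, c j = 0)
  (f_bounded : exists gamma : nat, forall p : free_alg R[i] rho,
    exists2 m : matalg ni g, in_M_fps di m &
      f p = matalg_scalar ni g (laurentT R[i] ^- gamma) * m)
  (f_fiber : alg_iso (@imring_scalar R[i] rho (matalg ni g) f)
                     (fun c : R[i] => c%:A : N)) :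
  flat_deformation iota N A.
Proof.
clear dimN; rewrite -card_position in sum_n; rewrite {n}sum_n in dimA f_free.
have [m [_ f_free']] := f_free.
have [gamma f_gamma] := f_bounded.
have A'_nontrivial : (1 : matalg ni g) != 0.
  apply: (@matalg_nontrivial _ ni di); apply/card_gt0P.
  pose i := Ordinal k'_gt0.
  by exists (Tagged (fun i => ('I_(ni i) * 'I_(ni i) * 'I_(di i))%type)
    (Ordinal (ni_gt0 i), Ordinal (ni_gt0 i), Ordinal (di_gt0 i))).
have [p [p_span p_unit]] :=
  bounded_image_basis di_gt0 g_monic g_deg f_linear f_gamma f_free'.
exists (image_alg f A'_nontrivial); split; first split.
- exact: (image_free_module f_linear A'_nontrivial p_span p_unit).
- exact: image_special_fiber.
- apply: alg_iso_trans (alg_iso_sym (wedderburn_tensor iota dimA A_wedderburn)).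
  exact: (image_tensor di_gt0 g_monic g_deg g_simple_roots f_linear A'_nontrivial
    p_span p_unit).
Qed.
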